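(* Let $n \ge 3$ and let $\mathcal Z : \mathrm{LC}_{sc}(\mathbb R^n) \to F(\mathbb R^n;\mathbb R)$ be a map. Then $\mathcal Z$ is a continuous and $\mathrm{SL}(n)$ contravariant valuation which is a translation conjugation on log-concave functions if and only if there is a constant $c \in \mathbb R$ such that $$\mathcal Z f = c\, f^\circ$$ for every $f \in \mathrm{LC}_{sc}(\mathbb R^n)$.
   Context: $\mathrm{Conv}_{sc}(\mathbb R^n)$ is the set of all lower semi-continuous convex functions $u:\mathbb R^n\to\mathbb R\cup\{\infty\}$ that are proper ($u\not\equiv\infty$) and super-coercive ($\lim_{|x|\to\infty} u(x)/|x|=\infty$). $\mathrm{LC}_{sc}(\mathbb R^n)=\{e^{-u}:u\in \mathrm{Conv}_{sc}(\mathbb R^n)\}$ (with $e^{-\infty}=0$). $F(\mathbb R^n;\mathbb R)$ is the set of all functions $\mathbb R^n\to\mathbb R$. The Legendre transform is $u^\ast(x)=\sup_{y\in\mathbb R^n}(x\cdot y-u(y))$, and for $f=e^{-u}$ we set $f^\circ=e^{-u^\ast}$. $f\vee g$ and $f\wedge g$ denote pointwise maximum and minimum. $\mathcal Z$ is a valuation if $\mathcal Z(f\vee g)+\mathcal Z(f\wedge g)=\mathcal Z f+\mathcal Z g$ whenever $f,g,f\vee g,f\wedge g\in \mathrm{LC}_{sc}(\mathbb R^n)$. $\mathcal Z$ is continuous if hypo-convergence $f_i\to f$ in $\mathrm{LC}_{sc}(\mathbb R^n)$ implies $\mathcal Z f_i\to\mathcal Z f$ pointwise; hypo-convergence of $f_i$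 to $f$ means that $u_i=-\log f_i$ epi-converges to $u=-\log f$, i.e. for every $x\in\mathbb R^n$, $u(x)\le\liminf_i u_i(x_i)$ for all $x_i\to x$, and there is a sequence $x_i\to x$ with $u(x)=\lim_i u_i(x_i)$. $\mathcal Z$ is $\mathrm{SL}(n)$ contravariant if $\mathcal Z(f\circ\phi^{-1})=(\mathcal Z f)\circ\phi^{t}$ for all $f$ and all $\phi\in \mathrm{SL}(n)$. For $y\in\mathbb R^n$ write $\tau_y f(x)=f(x-y)$ and $\ell_y(x)=x\cdot y$. $\mathcal Z$ is a translation conjugation on log-concave functions if $\mathcal Z(\tau_y f)=e^{-\ell_y}\mathcal Z(f)$ and $\mathcal Z(e^{-\ell_y}f)=\tau_y\mathcal Z(f)$ for all $f\in \mathrm{LC}_{sc}(\mathbb R^n)$ and $y\in\mathbb R^n$. *)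

(* Defs.v *)
From HB Require Import structures.
From mathcomp Require Import all_boot all_order all_algebra.
From mathcomp Require Import all_classical all_reals all_analysis.

Set Implicit Arguments.
Unset Strict Implicit.
Unset Printing Implicit Defensive.

Import Order.TTheory GRing.Theory Num.Theory.
Import numFieldNormedType.Exports.

Local Open Scope classical_set_scope.
Local Open Scope ring_scope.

Definition dotv (R : realType) (n : nat) (x y : 'cV[R]_n) : R :=
  \sum_(i < n) x i 0 * y i 0.

(* The library's norm on matrices is the sup norm, hence this definition. *)
Definition enorm (R : realType) (n : nat) (x : 'cV[R]_n) : R :=
  Num.sqrt (dotv x x).

(* The filter |x| -> oo. *)
Definition at_infinity (R : realType) (n : nat) : set_system 'cV[R]_n :=
  filter_from [set: R] (fun r => [set x | r < enorm x]).
Arguments at_infinity : clear implicits.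

Section ConvexFunctions.
Context (R : realType) (n : nat).
Implicit Types u : 'cV[R]_n -> \bar R.
Local Open Scope ereal_scope.

(* For functions that avoid -oo; in \bar R, 0 * +oo = 0, so that the cases
   t = 0 and t = 1 are harmless. *)
Definition econvex u : Prop :=
  forall (x y : 'cV[R]_n) (t : R), (0 <= t <= 1)%R ->
    u (t *: x + (1 - t) *: y)%R <= t%:E * u x + (1 - t)%:E * u y.

Definition super_coercive u : Prop :=
  u x * ((enorm x)^-1)%:E @[x --> at_infinity R n] --> +oo.

Definition Conv_sc u : Prop :=
  [/\ forall x, u x != -oo, exists x, u x != +oo,
      econvex u, lower_semicontinuous u & super_coercive u].

Definition legendre u (x : 'cV[R]_n) : \bar R :=
  ereal_sup (range (fun y => (dotv x y)%:E - u y)).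

Definition epi_converges (u_ : nat -> 'cV[R]_n -> \bar R) u : Prop :=
  forall x : 'cV[R]_n,
    (forall x_ : nat -> 'cV[R]_n, x_ @ \oo --> x ->
       u x <= limn_einf (fun i => u_ i (x_ i))) /\
    (exists2 x_ : nat -> 'cV[R]_n, x_ @ \oo --> x &
       u_ i (x_ i) @[i --> \oo] --> u x).

End ConvexFunctions.

Section LogConcaveFunctions.
Context (R : realType) (n : nat).
Implicit Types (f g : 'cV[R]_n -> R) (x y : 'cV[R]_n).

(* fine only casts to R: u avoids -oo on Conv_sc, so e^(-u) is finite. *)
Definition exp_neg (u : 'cV[R]_n -> \bar R) : 'cV[R]_n -> R :=
  fun x => fine (expeR (- u x)%E).

(* lne sends 0 to -oo, so neg_log f x = +oo where f x = 0. *)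
Definition neg_log f : 'cV[R]_n -> \bar R := fun x => (- lne (f x)%:E)%E.

Definition LC_sc : set ('cV[R]_n -> R) :=
  [set f | exists2 u, Conv_sc u & f = exp_neg u].

Definition polar f : 'cV[R]_n -> R := exp_neg (legendre (neg_log f)).

Definition hypo_converges (f_ : nat -> 'cV[R]_n -> R) f : Prop :=
  epi_converges (fun i => neg_log (f_ i)) (neg_log f).

Definition translate y f : 'cV[R]_n -> R := fun x => f (x - y).

Definition exp_linear y : 'cV[R]_n -> R := fun x => expR (- dotv x y).

(* A map defined on LC_sc is represented by a total Z; only its values on
   LC_sc are ever constrained. *)
Implicit Types Z : ('cV[R]_n -> R) -> ('cV[R]_n -> R).

Definition is_valuation Z : Prop :=
  forall f g, LC_sc f -> LC_sc g -> LC_sc (f \max g) -> LC_sc (f \min g) ->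
    Z (f \max g) \+ Z (f \min g) = Z f \+ Z g.

Definition hypo_continuous Z : Prop :=
  forall (f_ : nat -> 'cV[R]_n -> R) f,
    (forall i, LC_sc (f_ i)) -> LC_sc f -> hypo_converges f_ f ->
    forall x, Z (f_ i) x @[i --> \oo] --> Z f x.

Definition SL_contravariant Z : Prop :=
  forall f (phi : 'M[R]_n), LC_sc f -> \det phi = 1 ->
    Z (fun x => f (invmx phi *m x)) = (fun x => Z f (phi^T *m x)).

Definition translation_conjugation Z : Prop :=
  forall f y, LC_sc f ->
    Z (translate y f) = exp_linear y \* Z f /\
    Z (exp_linear y \* f) = translate y (Z f).

End LogConcaveFunctions.

(* Main.v *)
Require Import Defs.
From mathcomp Require Import all_boot all_order all_algebra.
From mathcomp Require Import all_classical all_reals all_analysis.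
From mathcomp Require Import ring lra.

Set Implicit Arguments.
Unset Strict Implicit.
Unset Printing Implicit Defensive.

Import Order.TTheory GRing.Theory Num.Theory.
Import numFieldNormedType.Exports.

Local Open Scope classical_set_scope.
Local Open Scope ring_scope.

(** The proof reduces the theorem to a statement about one real functional. The
    second conjugation rule recovers [Z f] from its value at the origin, since
    [Z f x] is the value at [0] of [Z] applied to a tilt of [f]. Put
    [z u = Z (exp_neg u) 0]. This functional on [Conv_sc] is continuous, a
    valuation, and invariant under SL(n) and translations; the two conjugation
    rules together give [z (u + r) = expR r * z u]. What has to be shown is that
    [z u] is a multiple of [expR (min u)], which is the value of the polar
    function at the origin.

    That the polar function has all the properties is proved in
    [polar_admissible]. At a slope [x] its value is [expR m], where [m] is the
    intercept of the supporting hyperplane of slope [x] of the epigraph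
    ([touches]). The valuation property then says that [m] is the minimum,
    respectively the maximum, of the two given intercepts, and the second case
    holds because two closed sets that cover a segment and both meet it have a
    common point. Continuity is convergence of minima under epi-convergence:
    coercivity of the limit, together with convexity, keeps minimizing points
    in a bounded region.

    Conversely, subtract from [Z] the multiple of the polar function that has
    the same value at the indicator function of the origin. The difference is a
    [null_functional], and [null_functional_eq0] shows that it is zero, as
    follows.

    - If [u] lives on a hyperplane, then the dilations of that hyperplane extend
      to maps of determinant one. Shrinking [u] horizontally thus does not
      change [z u], while the limit is a constant plus the indicator function of
      the origin; hence [z u = 0] ([vanish_flat]). By the valuation property,
      [z] is now additive when a function is cut along a hyperplane ([cut_eq]).

    - For an affine function on a product with a rectangle, additivity and the
      behaviour under translations force the value to be
      [K a b * (expR (a * L) - 1) * (expR (b * M) - 1)], where [a] and [b] are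
      the slopes along the sides [L] and [M]. A squeeze of determinant one shows
      that [K a b] depends on [a * b] only. Cutting a square along its diagonal
      and reassembling the halves into parallelograms gives
      [K 1 c = 2 * K 1 (2 * c)]. If however one slope tends to infinity, then
      the function converges to its restriction to a face, where [z] vanishes,
      so that [K 1 c] has to decay exponentially; hence [K = 0]
      ([rect_vanish]).

    - The part of a cylinder below the graph of an affine function can be moved
      from the bottom to the top, which yields a sheared cylinder. The values
      of both cylinders are zero, and the translation multiplies the value of
      the moved part by a factor other than one; so this value is zero
      ([truncated_cylinder_vanish]). Fourier-Motzkin elimination of two
      coordinates cuts every polytope into pieces of this kind
      ([elimination], [poly_vanish]).

    - A maximum of affine functions on a cube is cut into affine functions on
      polytopes, and such maxima are dense in [Conv_sc] ([maxaff_dense]). *)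

(** * The Euclidean structure and the sup norm *)

Section Vectors.
Context {R : realType} {n : nat}.
Implicit Types x y z : 'cV[R]_n.

Lemma dotvE x y : dotv x y = (x^T *m y) 0 0.
Proof. by rewrite mxE; apply: eq_bigr => i _; rewrite mxE. Qed.

Lemma dotvC x y : dotv x y = dotv y x.
Proof. by apply: eq_bigr => i _; rewrite mulrC. Qed.

Lemma dotvDr x y z : dotv x (y + z) = dotv x y + dotv x z.
Proof. by rewrite -big_split; apply: eq_bigr => i _; rewrite mxE mulrDr. Qed.

Lemma dotvZr a x y : dotv x (a *: y) = a * dotv x y.
Proof. by rewrite big_distrr; apply: eq_bigr => i _; rewrite mxE mulrCA. Qed.

Lemma dotvDl x y z : dotv (x + y) z = dotv x z + dotv y z.
Proof. by rewrite dotvC dotvDr !(dotvC z). Qed.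

Lemma dotvZl a x y : dotv (a *: x) y = a * dotv x y.
Proof. by rewrite dotvC dotvZr dotvC. Qed.

Lemma dotvNr x y : dotv x (- y) = - dotv x y.
Proof. by rewrite -scaleN1r dotvZr mulN1r. Qed.

Lemma dotvNl x y : dotv (- x) y = - dotv x y.
Proof. by rewrite dotvC dotvNr dotvC. Qed.

Lemma dotvBr x y z : dotv x (y - z) = dotv x y - dotv x z.
Proof. by rewrite dotvDr dotvNr. Qed.

Lemma dotvBl x y z : dotv (x - y) z = dotv x z - dotv y z.
Proof. by rewrite dotvDl dotvNl. Qed.

Lemma dotv0r x : dotv x 0 = 0.
Proof. by rewrite -(scale0r 0) dotvZr mul0r. Qed.

Lemma dotv0l x : dotv 0 x = 0.
Proof. by rewrite dotvC dotv0r. Qed.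

Lemma dotv_mulmxr (A : 'M[R]_n) x y : dotv x (A *m y) = dotv (A^T *m x) y.
Proof. by rewrite !dotvE trmx_mul trmxK mulmxA. Qed.

Definition evec (i : 'I_n) : 'cV[R]_n := delta_mx i 0.

Lemma dotv_evec x i : dotv x (evec i) = x i 0.
Proof.
rewrite /dotv (bigD1 i) //= big1 ?addr0 => [|j ji].
  by rewrite !mxE !eqxx mulr1.
by rewrite !mxE (negbTE ji) mulr0.
Qed.

Lemma evecE i j : evec i j 0 = (j == i)%:R.
Proof. by rewrite mxE eqxx andbT. Qed.

Lemma dotv_ge0 x : 0 <= dotv x x.
Proof. by apply: sumr_ge0 => i _; rewrite -expr2 sqr_ge0. Qed.

Lemma coord_le_norm x i : `|x i 0| <= `|x|.
Proof.
rewrite [leRHS]mx_normrE.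
by apply/bigmax_geP; right => /=; exists (i, 0).
Qed.

Lemma norm_le_coord x a : 0 <= a -> (forall i, `|x i 0| <= a) -> `|x| <= a.
Proof.
move=> a0 xa; rewrite [leLHS]mx_normrE; apply/bigmax_leP; split=> // -[i j] _ /=.
by rewrite ord1.
Qed.

Lemma norm_le_enorm x : `|x| <= enorm x.
Proof.
apply: norm_le_coord; first exact: sqrtr_ge0.
move=> i; rewrite /enorm -sqrtr_sqr ler_sqrt ?dotv_ge0 //.
rewrite /dotv (bigD1 i) //= -expr2 lerDl sumr_ge0 // => j _.
by rewrite -expr2 sqr_ge0.
Qed.

Lemma dotv_le_norm x y : `|dotv x y| <= n%:R * `|x| * `|y|.
Proof.
apply: le_trans (ler_norm_sum _ _ _) _.
rewrite -mulrA mulr_natl -[X in _ *+ X](card_ord n) -sumr_const.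
by apply: ler_sum => i _; rewrite normrM ler_pM // coord_le_norm.
Qed.

Lemma enorm_le_norm x : enorm x <= n%:R * `|x|.
Proof.
rewrite /enorm -[leRHS]ger0_norm ?mulr_ge0 // -sqrtr_sqr ler_sqrt ?sqr_ge0 //.
rewrite (le_trans (ler_norm _)) // (le_trans (dotv_le_norm _ _)) //.
rewrite expr2 -[leRHS]mulrA -[leLHS]mulrA ler_wpM2l //.
case: n x => [|m] x; first by rewrite flatmx0 normr0 mul0r.
by rewrite ler_wpM2l // ler_peMl // ler1n.
Qed.

Lemma dotv_continuous x : continuous (dotv x).
Proof.
move=> y; have FF := nbhs_filter y; apply/(@cvgrPdist_le _ R^o) => e e0.
have K0 : 0 < n%:R * `|x| + 1 by rewrite ltr_wpDl // mulr_ge0.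
near=> z; rewrite -dotvBr (le_trans (dotv_le_norm _ _)) //.
apply: (@le_trans _ _ ((n%:R * `|x| + 1) * `|y - z|)).
  by rewrite ler_wpM2r // lerDl.
rewrite mulrC -ler_pdivlMr //.
near: z; apply: cvgr_dist_le => //; exact: divr_gt0.
Unshelve. all: by end_near. Qed.

Lemma norm_trmx m k (M : 'M[R]_(m, k)) : `|M^T| <= `|M|.
Proof.
rewrite [leLHS]mx_normrE [leRHS]mx_normrE; apply/bigmax_leP; split.
  exact: bigmax_ge_id.
by move=> [i j] _ /=; apply/bigmax_geP; right => /=; exists (j, i); rewrite // mxE.
Qed.

(** Transposition carries the statement over from row vectors. *)
Lemma cV_bounded_closed_compact (A : set 'cV[R]_n) :
  bounded_set A -> closed A -> compact A.
Proof.
move=> bA cA.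
have tc m k : continuous (fun M : 'M[R]_(m, k) => M^T).
  move=> M; have FF := nbhs_filter M; apply/cvgrPdist_le => e e0; near=> N.
  rewrite -linearB (le_trans (norm_trmx _)) //.
pose B := [set v : 'rV[R]_n | A v^T].
have -> : A = (fun v : 'rV[R]_n => v^T) @` B.
  apply/seteqP; split=> [x Ax|_ [v Bv <-]] //=.
  by exists x^T; rewrite /B /= ?trmxK.
apply: continuous_compact; first by apply: continuous_subspaceT; exact: tc.
apply: bounded_closed_compact; last first.
  by apply: closed_comp => // x _; exact: tc.
have [M [Mr MA]] := bA; exists M; split => // N MN v Bv.
by rewrite /= -[v]trmxK (le_trans (norm_trmx _)) //; exact: MA N MN _ Bv.
Unshelve. all: by end_near. Qed.

Lemma closed_ball_compact x r : compact [set y : 'cV[R]_n | `|y - x| <= r].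
Proof.
apply: cV_bounded_closed_compact.
  exists (r + `|x|); split=> [|N rN y /= yx]; first exact: num_real.
  rewrite -[y](subrK x) (le_trans (ler_normD _ _)) //.
  by rewrite (le_trans _ (ltW rN)) // lerD2r.
apply: (@closed_comp _ _ (fun y => `|y - x|) [set t | t <= r]) => [y _|].
  have FF := nbhs_filter y.
  by apply: cvg_norm; apply: cvgB; [exact: cvg_id | exact: cvg_cst].
exact: closed_le.
Qed.

(** Affine functions are encoded by their slope and constant term, so that
    they inherit the vector space operations of pairs. *)
Definition aff (p : 'cV[R]_n * R) x : R := dotv p.1 x + p.2.

Lemma affB p q x : aff (p - q) x = aff p x - aff q x.
Proof. by rewrite /aff /= dotvBl; ring. Qed.

Lemma affD p q x : aff (p + q) x = aff p x + aff q x.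
Proof. by rewrite /aff /= dotvDl; ring. Qed.

Lemma affN p x : aff (- p) x = - aff p x.
Proof. by rewrite /aff /= dotvNl; ring. Qed.

Lemma affZ a p x : aff (a *: p) x = a * aff p x.
Proof. by rewrite /aff /= dotvZl /GRing.scale /= mulrDr. Qed.

Lemma aff_addr p x y : aff p (x + y) = aff p x + dotv p.1 y.
Proof. by rewrite /aff dotvDr addrAC. Qed.

Lemma aff_convex p x y t :
  aff p (t *: x + (1 - t) *: y) = t * aff p x + (1 - t) * aff p y.
Proof. by rewrite /aff dotvDr !dotvZr; ring. Qed.

Lemma aff_continuous p : continuous (aff p).
Proof.
move=> x; have FF := nbhs_filter x.
by apply: (@cvgD _ R^o); [exact: dotv_continuous | exact: cvg_cst].
Qed.

Lemma near_dist_le x (e : R) : 0 < e -> \forall y \near x, `|x - y| <= e.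
Proof.
move=> e0; have FF := nbhs_filter x.
by apply: (@cvgr_dist_le _ _ _ (nbhs x) FF id x) => //; exact: cvg_id.
Qed.

Lemma near_aff_gt p x (c : R) : c < aff p x -> \forall y \near x, c < aff p y.
Proof.
move=> cx; have FF := nbhs_filter x.
by apply: (@cvgr_gt _ _ (nbhs x) FF _ (aff p x) _ _ cx); exact: aff_continuous.
Qed.

End Vectors.
(** * Convex functions with values in the extended reals *)

Section ExtendedFunctions.
Context {R : realType} {n : nat}.
Implicit Types (x y : 'cV[R]_n) (u v : 'cV[R]_n -> \bar R) (D : set 'cV[R]_n).

Lemma lee_EFinP (a b : \bar R) :
  (forall r, (b < r%:E)%E -> (a <= r%:E)%E) -> (a <= b)%E.
Proof.
case: b => [b| |] h.
- apply/lee_addgt0Pr => e e0; rewrite -EFinD; apply: h.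
  by rewrite lte_fin ltrDl.
- by rewrite leey.
- case: a h => [a| |] h //.
    by have := h (a - 1)%R (ltNyr _); rewrite lee_fin => ?; exfalso; lra.
  by have := h 0%R (ltNyr _).
Qed.

Lemma econvex_le u x y (t a b : R) : econvex u -> 0 <= t <= 1 ->
  (u x <= a%:E)%E -> (u y <= b%:E)%E ->
  (u (t *: x + (1 - t) *: y)%R <= (t * a + (1 - t) * b)%:E)%E.
Proof.
move=> cu t01 ua ub; apply: le_trans (cu x y t t01) _.
have /andP[t0 t1] := t01; rewrite [leRHS]EFinD !EFinM; apply: leeD.
  by apply: lee_wpmul2l; rewrite ?lee_fin.
by apply: lee_wpmul2l; rewrite ?lee_fin ?subr_ge0.
Qed.

(** Convexity only has to be tested on finite upper bounds: this avoids
    products of the form [0 * +oo]. *)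
Lemma econvexP u : (forall x, u x != -oo%E) ->
  (forall x y (t a b : R), 0 <= t <= 1 -> (u x <= a%:E)%E -> (u y <= b%:E)%E ->
     (u (t *: x + (1 - t) *: y)%R <= (t * a + (1 - t) * b)%:E)%E) -> econvex u.
Proof.
move=> uNy cu x y t t01; have /andP[t0 t1] := t01.
have [->|tn0] := eqVneq t 0.
  by rewrite scale0r add0r subr0 scale1r mul0e add0e mul1e.
have [->|tn1] := eqVneq t 1.
  by rewrite scale1r subrr scale0r addr0 mul1e mul0e adde0.
have tp : 0 < t by rewrite lt_neqAle eq_sym tn0.
have sp : 0 < 1 - t by rewrite subr_gt0 lt_neqAle tn1.
have := uNy x; have := uNy y; have := cu x y t.
case: (u x) => [a| |] //; case: (u y) => [b| |] // h _ _.
- by rewrite -!EFinM -EFinD; exact: h.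
- by rewrite -EFinM gt0_muley ?lte_fin // addeC leey.
- by rewrite -EFinM gt0_muley ?lte_fin // leey.
- by rewrite !gt0_muley ?lte_fin // leey.
Qed.

Lemma lscP u x (a : R) : lower_semicontinuous u -> (a%:E < u x)%E ->
  \forall y \near x, (a%:E < u y)%E.
Proof. by move=> lu /lu[W xW Wu]; apply: filterS xW. Qed.

(** The open sets where [u] exceeds [- i] increase to the whole space. *)
Lemma lsc_compact_lower_bound u K : compact K -> lower_semicontinuous u ->
  (forall x, u x != -oo%E) -> exists m : R, forall x, K x -> (m%:E <= u x)%E.
Proof.
move=> /compact_near_coveringP cK lu uNy.
have /(_ _)[|i Hi] := @filter_ex _ \oo _ _
   (cK nat \oo (fun i x => ((- i%:R)%:E < u x)%E) _ _).
  move=> x Kx.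
  have [m um] : exists m : nat, ((- m%:R)%:E < u x)%E.
    have := uNy x; case: (u x) => [a| |] // _; last by exists 0%N; rewrite ltry.
    exists (Num.bound `|a|); rewrite lte_fin ltrNl.
    by rewrite (le_lt_trans (ler_norm _)) // normrN archi_boundP.
  exists ([set y | ((- m%:R)%:E < u y)%E], [set i | (m <= i)%N]) => /=.
    by split; [exact: lscP | exact: nbhs_infty_ge].
  move=> [y i] /= [uy mi]; apply: le_lt_trans uy.
  by rewrite lee_fin lerN2 ler_nat.
by exists (- i%:R) => x /Hi /ltW.
Qed.

(** Superlinear growth, in the form that survives bounded perturbations: no
    quotient by the norm occurs, and the constant absorbs what happens on
    bounded sets. *)
Definition coercive D u := forall A : R, exists B : R,
  forall x, D x -> ((A * `|x| - B)%:E <= u x)%E.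

Lemma at_infinity_filter : Filter (at_infinity R n).
Proof.
apply: filter_from_filter; first by exists 0.
move=> i j _ _; exists (Num.max i j) => // x /=.
by rewrite gt_max => /andP[].
Qed.

(** Lower semicontinuity bounds [u] from below on a ball, which allows the
    quotient by the norm to be traded for an additive constant. *)
Lemma Conv_scP u : Conv_sc u <->
  [/\ coercive setT u, exists x, u x != +oo%E, econvex u &
      lower_semicontinuous u].
Proof.
have FF := at_infinity_filter.
split=> [[uNy pu cu lu su]|[su pu cu lu]].
  split=> // A.
  have [r _ Hr] : at_infinity R n
      [set x | (`|A|%:E <= u x * ((enorm x)^-1)%:E)%E].
    by move/cvgeyPge: su; exact.
  have [m Hm] := lsc_compact_lower_bound (@closed_ball_compact _ _ 0 (Num.max r 0)) lu uNy.
  exists (`|A| * Num.max r 0 + `|m|) => x _.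
  have Ax : A * `|x| <= `|A| * `|x| by rewrite ler_wpM2r // ler_norm.
  have [xr|xr] := leP (enorm x) (Num.max r 0).
    apply: le_trans (Hm x _); last by rewrite /= subr0 (le_trans (norm_le_enorm _)).
    rewrite lee_fin opprD addrA (@le_trans _ _ (- `|m|)) //; last first.
      by rewrite lerNl -normrN ler_norm.
    rewrite gerDr subr_le0 (le_trans Ax) // ler_wpM2l //.
    by rewrite (le_trans (norm_le_enorm _)).
  move: xr; rewrite gt_max => /andP[rx ex].
  have := Hr x rx; rewrite /= lee_pdivlMr // => h.
  apply: le_trans h; rewrite -EFinM lee_fin lerBlDr.
  rewrite (le_trans Ax) // (le_trans (ler_wpM2l _ (norm_le_enorm _))) //.
  by rewrite lerDl addr_ge0 // mulr_ge0 // le_max lexx orbT.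
split=> // [x|].
  by have [B /(_ x I)] := su 0; case: (u x).
apply/cvgeyPge => A.
pose k : R := n%:R + 1; have k0 : 0 < k by rewrite ltr_wpDl.
have [B HB] := su (k * (`|A| + 1)); exists `|B| => //= x Bx.
have ex : 0 < enorm x by apply: le_lt_trans Bx.
rewrite lee_pdivlMr // -EFinM; apply: le_trans (HB x I); rewrite lee_fin.
have kx : enorm x <= k * `|x|.
  by rewrite (le_trans (enorm_le_norm _)) // ler_wpM2r // lerDl.
rewrite lerBrDr mulrAC mulrDr mulr1; apply: lerD.
  rewrite (le_trans (ler_wpM2r (ltW ex) (ler_norm A))) // mulrC ler_wpM2r //.
by rewrite (le_trans _ kx) // (le_trans _ (ltW Bx)) // ler_norm.
Qed.

(** If the infimum [s] is not attained, then the open sets where [u] exceeds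
    [s + 1 / i] cover the space; one of them contains a ball outside of which
    [u] is large, and [s] is not the infimum. *)
Lemma coercive_minimizer u : coercive setT u -> (exists x, u x != +oo%E) ->
  lower_semicontinuous u -> exists y, forall x, (u y <= u x)%E.
Proof.
move=> su [x0 ux0] lu.
have [B0 HB0] := su 0; have [B1 HB1] := su 1.
have lb x : ((- B0)%:E <= u x)%E by have := HB0 x I; rewrite mul0r sub0r.
have [a ua] : exists a, u x0 = a%:E.
  by exists (fine (u x0)); move: ux0 (lb x0); case: (u x0).
pose s := ereal_inf (range u).
have sE : s \is a fin_num.
  rewrite fin_numE; apply/andP; split.
    apply/eqP => sN; have : ((- B0)%:E <= s)%E.
      by apply/le_ereal_inf_tmp => _ [x _ <-].
    by rewrite sN leeNy_eq.
  apply/eqP => sy; have : (s <= u x0)%E by apply: ereal_inf_lbound; exists x0.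
  by rewrite sy ua leye_eq.
have s_le x : (s <= u x)%E by apply: ereal_inf_lbound; exists x.
apply: contrapT => /forallNP nomin.
have slt x : (s < u x)%E.
  rewrite lt_neqAle s_le andbT; apply/eqP => sx; apply: (nomin x) => y.
  by rewrite -sx.
(* Outside of this ball [u] is at least [a + 1], where [a] is one of its values. *)
have /compact_near_coveringP cK := @closed_ball_compact R n 0 (a + 1 + B1).
suff /filter_ex[i Hi] : \forall i \near \oo,
    [set y : 'cV[R]_n | `|y - 0| <= a + 1 + B1]
    `<=` [set x | (s + (i.+1%:R^-1)%:E < u x)%E].
  have : (s + (i.+1%:R^-1)%:E <= s)%E.
    apply/le_ereal_inf_tmp => _ [x _ <-].
    have [xK|xK] := leP `|x| (a + 1 + B1).
      by apply/ltW/Hi; rewrite /= subr0.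
    apply: (@le_trans _ _ (a + 1)%:E).
      rewrite EFinD; apply: leeD; first by rewrite -ua s_le.
      by rewrite lee_fin invf_le1 // ler1n.
    apply: le_trans (HB1 x I); rewrite lee_fin mul1r lerBrDr; exact: ltW.
  rewrite -[X in (_ <= X)%E]adde0 leeD2lE // lee_fin.
  by rewrite leNgt invr_gt0 ltr0n.
apply: cK => x _.
have [e e0 ex] : exists2 e, 0 < e & (s + e%:E < u x)%E.
  have := slt x; rewrite -(fineK sE); case: (u x) => [r| |] //; last first.
    by exists 1 => //; rewrite -EFinD ltry.
  rewrite lte_fin => sr; exists ((r - fine s) / 2); first by rewrite divr_gt0 ?subr_gt0.
  by rewrite -EFinD lte_fin; lra.
have [m _ Hm] := near_infty_natSinv_lt (PosNum e0).
exists ([set y | (s + e%:E < u y)%E], [set i | (m <= i)%N]) => /=.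
  split; last exact: nbhs_infty_ge.
  by move: ex; rewrite -(fineK sE) -EFinD; exact: lscP.
move=> [y i] /= [uy mi]; apply: le_lt_trans uy.
by rewrite leeD2l // lee_fin ltW //; exact: Hm.
Qed.

Lemma Conv_sc_minimizer u : Conv_sc u -> exists y, forall x, (u y <= u x)%E.
Proof. by move=> /Conv_scP[su pu _ lu]; exact: coercive_minimizer. Qed.

End ExtendedFunctions.
(** * Restrictions, affine changes of variables, tilts *)

Section Constructions.
Context {R : realType} {n : nat}.
Implicit Types (x y : 'cV[R]_n) (u v : 'cV[R]_n -> \bar R) (D E : set 'cV[R]_n).

(** The sum of [u] and of the convex indicator function of [D]. *)
Definition restr D u x : \bar R := if x \in D then u x else +oo%E.

Lemma restr_in D u x : D x -> restr D u x = u x.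
Proof. by move=> Dx; rewrite /restr mem_set. Qed.

Lemma restr_out D u x : ~ D x -> restr D u x = +oo%E.
Proof. by move=> Dx; rewrite /restr memNset. Qed.

Lemma le_restr D u x : (u x <= restr D u x)%E.
Proof. by rewrite /restr; case: ifP => // _; rewrite leey. Qed.

Lemma restr_le D u x (a : R) : (restr D u x <= a%:E)%E <-> D x /\ (u x <= a%:E)%E.
Proof.
have [Dx|Dx] := pselect (D x); first by rewrite restr_in //; split=> // -[].
by rewrite restr_out //; split=> // -[].
Qed.

Lemma restr_proper D u x : restr D u x != +oo%E <-> D x /\ u x != +oo%E.
Proof.
have [Dx|Dx] := pselect (D x); first by rewrite restr_in //; split=> // -[].
by rewrite restr_out // eqxx; split=> // -[].
Qed.

Lemma restr_restr D E u : restr D (restr E u) = restr (D `&` E) u.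
Proof.
apply/funext => x; have [Dx|Dx] := pselect (D x); last first.
  by rewrite !restr_out // => -[].
rewrite [LHS]restr_in //; have [Ex|Ex] := pselect (E x).
  by rewrite !restr_in.
by rewrite !restr_out // => -[].
Qed.

Lemma eq_restr D u v : (forall x, D x -> u x = v x) -> restr D u = restr D v.
Proof.
move=> uv; apply/funext => x; have [Dx|Dx] := pselect (D x).
  by rewrite !restr_in // uv.
by rewrite !restr_out.
Qed.

Lemma restr_eq D E u v x y : (D x <-> E y) -> (D x -> u x = v y) ->
  restr D u x = restr E v y.
Proof.
move=> DE uv; have [Dx|Dx] := pselect (D x).
  by rewrite !restr_in ?uv //; exact/DE.
by rewrite !restr_out // => /DE.
Qed.

Lemma restr_comp D u (T : 'cV[R]_n -> 'cV[R]_n) :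
  (fun x => restr D u (T x)) = restr (T @^-1` D) (u \o T).
Proof. by apply/funext => x; exact: restr_eq. Qed.

Definition convex_set D := forall x y (t : R), D x -> D y -> 0 <= t <= 1 ->
  D (t *: x + (1 - t) *: y).

Lemma convex_setI D E : convex_set D -> convex_set E -> convex_set (D `&` E).
Proof. by move=> cD cE x y t [Dx Ex] [Dy Ey] t01; split; [exact: cD|exact: cE]. Qed.

Lemma Conv_sc_restr D v : closed D -> convex_set D -> econvex v ->
  lower_semicontinuous v -> coercive D v ->
  (exists x, D x /\ v x != +oo%E) -> Conv_sc (restr D v).
Proof.
move=> clD cD cv lv sv [x0 [Dx0 vx0]].
have su : coercive setT (restr D v).
  move=> A; have [B HB] := sv A; exists B => x _.
  have [Dx|Dx] := pselect (D x); first by rewrite restr_in // HB.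
  by rewrite restr_out // leey.
apply/Conv_scP; split=> //.
- by exists x0; rewrite restr_in.
- apply: econvexP => [x|x y t a b t01 /restr_le[Dx vx] /restr_le[Dy vy]].
    by have [B /(_ x I)] := su 0; case: (restr D v x).
  by apply/restr_le; split; [exact: cD | exact: econvex_le].
- move=> x a; have [Dx|Dx] := pselect (D x).
    rewrite restr_in // => /lv[W xW Wv]; exists W => // y /Wv h.
    exact: lt_le_trans (le_restr _ _ _).
  move=> _; exists (~` D); first by apply: open_nbhs_nbhs; split; first exact: closed_openC.
  by move=> y Dy; rewrite restr_out // ltry.
Qed.

Lemma Conv_sc_coercive u D : Conv_sc u -> coercive D u.
Proof. by move=> /Conv_scP[su _ _ _] A; have [B HB] := su A; exists B => x _; exact: HB. Qed.

Lemma Conv_sc_restrI D u : Conv_sc u -> closed D -> convex_set D ->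
  (exists x, D x /\ u x != +oo%E) -> Conv_sc (restr D u).
Proof.
move=> cu clD cD Du; have [_ _ eu lu _] := cu.
by apply: Conv_sc_restr => //; exact: Conv_sc_coercive.
Qed.

(** The bound by [K] keeps the growth superlinear: [L] must not shrink large
    vectors by more than a constant factor. *)
Lemma Conv_sc_comp u (L : 'cV[R]_n -> 'cV[R]_n) (K : R) : Conv_sc u ->
  continuous L ->
  (forall x y (t : R), L (t *: x + (1 - t) *: y) = t *: L x + (1 - t) *: L y) ->
  (forall x, `|x| <= K * (`|L x| + 1)) ->
  (exists x, u (L x) != +oo%E) -> Conv_sc (u \o L).
Proof.
move=> /Conv_scP[su _ cu lu] cL aL KL pL.
apply/Conv_scP; split=> //=.
- move=> A; have K0 : 0 <= `|K| by [].
  have [B HB] := su (`|A| * `|K|); exists (B + `|A| * `|K|) => x _.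
  apply: le_trans (HB (L x) I); rewrite lee_fin opprD addrCA addrC.
  rewrite lerD2r lerBlDr -[X in _ + X]mulr1 -mulrDr.
  rewrite (le_trans (ler_wpM2r _ (ler_norm A))) // -mulrA ler_wpM2l //.
  rewrite (le_trans (KL x)) // ler_wpM2r ?ler_norm // addr_ge0 //.
- by move=> x y t t01 /=; rewrite aL; exact: cu.
- move=> x a /= /lu[W xW Wu]; exists (L @^-1` W); first exact: cL.
  by move=> y /Wu.
Qed.

Lemma Conv_sc_shift u y : Conv_sc u -> Conv_sc (fun x => u (x + y)).
Proof.
move=> cu; have [_ [x0 ux0] _ _ _] := cu.
apply: (@Conv_sc_comp u (fun x => x + y) (1 + `|y|)) => //.
- move=> x; have FF := nbhs_filter x.
  by apply: cvgD; [exact: cvg_id | exact: cvg_cst].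
- by move=> a b t; rewrite !scalerDr addrACA -scalerDl addrC subrKC scale1r addrC.
- move=> x; rewrite -{1}[x](addrK y) (le_trans (ler_normB _ _)) //.
  rewrite mulrDl mul1r mulrDr mulr1.
  have : 0 <= `|y| * `|x + y| by rewrite mulr_ge0.
  by lra.
- by exists (x0 - y); rewrite subrK.
Qed.

Lemma mulmx_norm_le (A : 'M[R]_n) : exists2 K : R, 0 <= K & forall x, `|A *m x| <= K * `|x|.
Proof.
exists (n%:R * `|A|); first by rewrite mulr_ge0.
move=> x; apply: norm_le_coord => [|i]; first by rewrite !mulr_ge0.
have -> : (A *m x) i 0 = dotv (row i A)^T x.
  by rewrite mxE; apply: eq_bigr => j _; rewrite !mxE.
rewrite (le_trans (dotv_le_norm _ _)) // ler_wpM2r // ler_wpM2l //.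
apply: norm_le_coord => // j; rewrite !mxE [leRHS]mx_normrE.
by apply/bigmax_geP; right => /=; exists (i, j).
Qed.

Lemma mulmx_continuous (A : 'M[R]_n) : continuous (fun x : 'cV[R]_n => A *m x).
Proof.
have [K K0 HK] := mulmx_norm_le A.
move=> x; have FF := nbhs_filter x; apply/cvgrPdist_le => e e0.
have K1 : 0 < K + 1 by rewrite ltr_wpDl.
near=> z; rewrite -mulmxBr (le_trans (HK _)) //.
apply: (@le_trans _ _ ((K + 1) * `|x - z|)); first by rewrite ler_wpM2r // lerDl.
rewrite mulrC -ler_pdivlMr //.
by near: z; apply: cvgr_dist_le => //; exact: divr_gt0.
Unshelve. all: by end_near. Qed.

Lemma Conv_sc_mulmx u (A : 'M[R]_n) : A \in unitmx -> Conv_sc u ->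
  Conv_sc (fun x => u (A *m x)).
Proof.
move=> uA cu; have [_ [x0 ux0] _ _ _] := cu.
have [K K0 HK] := mulmx_norm_le (invmx A).
apply: (@Conv_sc_comp u (fun x => A *m x) K) => //.
- exact: mulmx_continuous.
- by move=> x y t; rewrite mulmxDr -!scalemxAr.
- move=> x; rewrite -{1}[x](mulKmx uA) (le_trans (HK _)) //.
  by rewrite ler_wpM2l // lerDl.
- by exists (invmx A *m x0); rewrite mulKVmx.
Qed.

(** Growth of order [A + n * `|p.1|] of [u] leaves order [A] for the sum. *)
Lemma Conv_sc_add_aff u p : Conv_sc u -> Conv_sc (fun x => u x + (aff p x)%:E)%E.
Proof.
move=> /Conv_scP[su [x0 ux0] cu lu]; apply/Conv_scP; split.
- move=> A; have [B HB] := su (A + n%:R * `|p.1|).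
  exists (B - p.2) => x _.
  have -> : A * `|x| - (B - p.2) =
     ((A + n%:R * `|p.1|) * `|x| - B) + (- (n%:R * `|p.1| * `|x|) + p.2) by ring.
  rewrite EFinD; apply: leeD; first exact: HB.
  rewrite lee_fin lerD2r lerNl (le_trans (ler_norm _)) // normrN.
  exact: dotv_le_norm.
- by exists x0; move: ux0; case: (u x0).
- have uNy x : u x != -oo%E by have [B /(_ x I)] := su 0; case: (u x).
  apply: econvexP => [x|x y t a b t01].
    by have := uNy x; case: (u x).
  rewrite -!leeBrDr // -!EFinB => ux uy.
  apply: le_trans (econvex_le cu t01 ux uy) _.
  by rewrite lee_fin aff_convex le_eqVlt; apply/orP; left; apply/eqP; ring.
- move=> x a ax.
  have [b bu ab] : exists2 b : R, (b%:E < u x)%E & a < b + aff p x.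
    move: ax; case: (u x) => [c| |] //=.
      rewrite -EFinD lte_fin => ax.
      exists (c - (c + aff p x - a) / 2); first by rewrite lte_fin; lra.
      by lra.
    by exists (a - aff p x + 1); rewrite ?ltry //; lra.
  have FF := nbhs_filter x.
  exists [set y | (b%:E < u y)%E /\ a - b < aff p y].
    apply: filterI; first exact: lscP.
    by apply: near_aff_gt; lra.
  move=> y [buy aby]; apply: (@lt_le_trans _ _ (b%:E + (aff p y)%:E)%E).
    by rewrite -EFinD lte_fin; lra.
  by apply: leeD => //; exact: ltW.
Qed.

Lemma closed_aff_le p : closed [set x : 'cV[R]_n | aff p x <= 0].
Proof.
apply: (@closed_comp _ _ (aff p) [set t | t <= 0]) => [y _|]; first exact: aff_continuous.
exact: closed_le.
Qed.

Lemma convex_aff_le p : convex_set [set x : 'cV[R]_n | aff p x <= 0].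
Proof.
move=> x y t /= px py /andP[t0 t1]; rewrite aff_convex.
have := mulr_ge0_le0 t0 px; have : 0 <= 1 - t by lra.
by move=> /mulr_ge0_le0 /(_ py); lra.
Qed.

End Constructions.
(** * Epi-convergence *)

Section ExtendedSequences.
Context {R : realType}.
Implicit Types (a : nat -> \bar R) (l b : \bar R).

Lemma lee_approx_below l b :
  (forall M : R, (M%:E < l)%E -> (M%:E <= b)%E) -> (l <= b)%E.
Proof.
move=> h; rewrite -leeN2; apply: lee_EFinP => r.
by rewrite lteNl -EFinN => /h; rewrite EFinN leeNl.
Qed.

Lemma limn_einf_ge a l : (forall M : R, (M%:E < l)%E ->
  \forall i \near \oo, (M%:E <= a i)%E) -> (l <= limn_einf a)%E.
Proof.
move=> h; rewrite limn_einf_lim (cvg_lim _ (@cvg_einfs_sup _ a)) //.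
apply: lee_approx_below => M /h[N _ HN].
apply: le_trans (ereal_sup_ubound _) => /=; last by exists N.
by apply: le_ereal_inf_tmp => _ [k Nk <-]; exact: HN.
Qed.

Lemma limn_einf_gt a (M : R) : (M%:E < limn_einf a)%E ->
  \forall i \near \oo, (M%:E < a i)%E.
Proof.
rewrite limn_einf_lim (cvg_lim _ (@cvg_einfs_sup _ a)) //.
move=> /ereal_sup_gt[_ [N _ <-] MN]; exists N => // k Nk.
by apply: lt_le_trans MN _; apply: ereal_inf_lbound; exists k.
Qed.

Lemma cvge_approx a l : l != -oo%E ->
  (forall M : R, (M%:E < l)%E -> \forall i \near \oo, (M%:E < a i)%E) ->
  (forall M : R, (l < M%:E)%E -> \forall i \near \oo, (a i <= M%:E)%E) ->
  a @ \oo --> l.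
Proof.
case: l => [l| |] // _ lo up; last first.
  by apply/cvgeyPgt => A; apply: lo; rewrite ltry.
have lo1 : \forall i \near \oo, ((l - 1)%:E < a i)%E by apply: lo; rewrite lte_fin; lra.
have up1 : \forall i \near \oo, (a i <= (l + 1)%:E)%E by apply: up; rewrite lte_fin; lra.
apply/fine_cvgP; split.
  by apply: filterS2 lo1 up1 => i; case: (a i).
apply/cvgrPdist_le => e e0.
have lo2 : \forall i \near \oo, ((l - e)%:E < a i)%E by apply: lo; rewrite lte_fin; lra.
have up2 : \forall i \near \oo, (a i <= (l + e)%:E)%E by apply: up; rewrite lte_fin; lra.
near=> i; have h1 : ((l - e)%:E < a i)%E by near: i.
have h2 : (a i <= (l + e)%:E)%E by near: i.
move: h1 h2; rewrite /=; case: (a i) => [r| |] //=.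
by rewrite lte_fin lee_fin => ? ?; rewrite ler_norml; apply/andP; split; lra.
Unshelve. all: by end_near. Qed.

End ExtendedSequences.

Section EpiConvergence.
Context {R : realType} {n : nat}.
Implicit Types (x y : 'cV[R]_n) (u v : 'cV[R]_n -> \bar R) (us : nat -> 'cV[R]_n -> \bar R).

(** The lower half of epi-convergence, stated with neighbourhoods instead of
    sequences: this is the form that combines with compactness. *)
Definition epi_liminf us u := forall x (M : R), (M%:E < u x)%E ->
  \forall y \near x & i \near \oo, (M%:E < us i y)%E.

Lemma epi_convergesI us u : (forall x, u x != -oo%E) -> epi_liminf us u ->
  (forall x, exists2 x_ : nat -> 'cV[R]_n, x_ @ \oo --> x &
     forall M : R, (u x < M%:E)%E -> \forall i \near \oo, (us i (x_ i) <= M%:E)%E) ->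
  epi_converges us u.
Proof.
move=> uNy lo up x.
have lo' (x_ : nat -> 'cV[R]_n) : x_ @ \oo --> x -> forall M : R, (M%:E < u x)%E ->
    \forall i \near \oo, (M%:E < us i (x_ i))%E.
  move=> xx M /lo[[A B] /= [xA [N _ NB]] AB].
  have xAn : \forall i \near \oo, A (x_ i) by apply: xx.
  have Nn : \forall i \near \oo, (N <= i)%N by exact: nbhs_infty_ge.
  by apply: filterS2 xAn Nn => i Ai Ni; apply: (AB (x_ i, i)); split=> //; exact: NB.
split=> [x_ xx|].
  by apply: limn_einf_ge => M /(lo' _ xx); apply: filterS => i /ltW.
have [x_ xx xu] := up x; exists x_ => //.
by apply: cvge_approx => //; exact: lo'.
Qed.

(** A sequence that violates the neighbourhood form is turned into one that
    violates the sequential form: bad points [y k] occur at indices [i k >= k],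
    and all other terms are put equal to [x]. *)
Lemma epi_converges_liminf us u : epi_converges us u -> epi_liminf us u.
Proof.
move=> ec x M Mu; apply: contrapT => bad.
have FF := nbhs_filter x.
have {bad} bad k : exists yi : 'cV[R]_n * nat,
    [/\ `|x - yi.1| <= k.+1%:R^-1, (k <= yi.2)%N & (us yi.2 yi.1 <= M%:E)%E].
  apply: contrapT => /forallNP no; apply: bad.
  exists ([set y | `|x - y| <= k.+1%:R^-1], [set i | (k <= i)%N]) => /=.
    split; last exact: nbhs_infty_ge.
    by apply: near_dist_le; rewrite invr_gt0 ltr0n.
  move=> [y i] /= [xy ki]; rewrite ltNge; apply/negP => uM.
  by apply: (no (y, i)).
have [f Hf] := choice bad.
pose x_ i := if pselect (exists k, (f k).2 = i) is left e then (f (projT1 (cid e))).1 else x.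
have xx : x_ @ \oo --> x.
  apply/cvgrPdist_le => e e0.
  have [K _ HK] := near_infty_natSinv_lt (PosNum e0).
  exists (\max_(k < K) (f k).2).+1 => // i /= Ki.
  rewrite /x_; case: pselect => [ex|_]; last by rewrite subrr normr0 ltW.
  case: (cid ex) => /= k ki; have [h _ _] := Hf k.
  apply: (le_trans h); apply/ltW/HK => /=; rewrite leqNgt; apply/negP => kK.
  move: Ki; rewrite ltnNge => /negP; apply.
  by rewrite -ki (@leq_bigmax _ (fun k : 'I_K => (f k).2) (Ordinal kK)).
have [/(_ x_ xx) h _] := ec x.
have [N _ HN] := limn_einf_gt (lt_le_trans Mu h).
have [_ Ni _] := Hf N; have := HN _ Ni; rewrite /x_.
case: pselect => [ex|]; last by case; exists N.
case: (cid ex) => /= k ki; have [_ _ h2] := Hf k.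
by rewrite -ki ltNge h2.
Qed.

(** Recovery sequences can often be taken constant. *)
Lemma epi_converges_pointwise us u : (forall x, u x != -oo%E) -> epi_liminf us u ->
  (forall x (M : R), (u x < M%:E)%E -> \forall i \near \oo, (us i x <= M%:E)%E) ->
  epi_converges us u.
Proof.
move=> uNy lo up; apply: epi_convergesI => // x.
by exists (fun=> x); [exact: cvg_cst | exact: up].
Qed.

Lemma epi_liminf_minorant us u : lower_semicontinuous u ->
  (forall i x, (u x <= us i x)%E) -> epi_liminf us u.
Proof.
move=> lu uu x M Mu.
exists ([set y | (M%:E < u y)%E], setT) => /=.
  by split; [exact: lscP | exact: filterT].
by move=> [y i] /= [My _]; exact: lt_le_trans (uu _ _).
Qed.

(** Adding a vanishing multiple of an affine function does not change the
    limit, provided that it is nonnegative on the domain. *)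
Lemma epi_converges_perturb u p : Conv_sc u ->
  (forall x, u x != +oo%E -> 0 <= aff p x) ->
  epi_converges (fun i x => u x + (aff (i.+1%:R^-1 *: p) x)%:E)%E u.
Proof.
move=> cu pu; have [uNy _ _ lu _] := cu.
apply: epi_converges_pointwise => //.
  apply: epi_liminf_minorant => // i x.
  have := pu x; case: (u x) (uNy x) => [r| |] // _ /(_ isT) p0.
  by rewrite -EFinD lee_fin lerDl affZ mulr_ge0.
move=> x M uM.
have := pu x; case: (u x) uM (uNy x) => [r| |] //; rewrite lte_fin => rM _ /(_ isT) p0.
have q0 : 0 < aff p x + 1 by rewrite ltr_wpDl.
have [N _ HN] : \forall i \near \oo, i.+1%:R^-1 < (M - r) / (aff p x + 1).
  have e0 : 0 < (M - r) / (aff p x + 1) by rewrite divr_gt0 // subr_gt0.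
  exact: (near_infty_natSinv_lt (PosNum e0)).
exists N => // i /HN /=; rewrite ltr_pdivlMr // => h.
rewrite -EFinD lee_fin affZ; have : 0 <= i.+1%:R^-1 :> R by [].
by move: h; move: (i.+1%:R^-1 : R) => s; rewrite mulrDr; lra.
Qed.

(** Penalizing the positivity of [p] ever more strongly restricts [u] to the
    zero set of [p]. *)
Lemma epi_converges_penalty u p : Conv_sc u ->
  (forall x, u x != +oo%E -> 0 <= aff p x) ->
  epi_converges (fun i x => u x + (aff (i.+1%:R *: p) x)%:E)%E
    (restr [set x | aff p x = 0] u).
Proof.
move=> cu pu; have [uNy _ _ lu _] := cu.
have [c Hc] : exists c, forall x, (c%:E <= u x)%E.
  have [B HB] := Conv_sc_coercive setT cu 0; exists (- B) => x.
  by have := HB x I; rewrite mul0r sub0r.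
have ge i x : (u x <= u x + (aff (i.+1%:R *: p) x)%:E)%E.
  have := pu x; case: (u x) (uNy x) => [r| |] // _ /(_ isT) p0.
  by rewrite -EFinD lee_fin lerDl affZ mulr_ge0.
apply: epi_converges_pointwise.
- move=> x; have [px|px] := pselect (aff p x = 0); first by rewrite restr_in.
  by rewrite restr_out.
- move=> x M; have [px|px] := pselect (aff p x = 0).
    by rewrite restr_in //; exact: epi_liminf_minorant.
  move=> _; have [xneg|xpos] := ltP (aff p x) 0.
    exists ([set y | - aff p x / 2 < aff (- p) y], setT) => /=.
      split; last exact: filterT.
      by apply: near_aff_gt; rewrite affN; lra.
    move=> [y i] /= [+ _]; rewrite affN => hy.
    have := pu y; case: (u y) (uNy y) => [r| |] // _.
      by move=> /(_ isT) h; exfalso; lra.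
    by rewrite ltry.
  have {px xpos} px : 0 < aff p x by rewrite lt_neqAle xpos andbT eq_sym; apply/eqP.
  pose k := Num.bound (`|M - c| / (aff p x / 2)).
  exists ([set y | aff p x / 2 < aff p y], [set i | (k <= i)%N]) => /=.
    by split; [apply: near_aff_gt; lra | exact: nbhs_infty_ge].
  move=> [y i] /= [hy ki]; have := Hc y; case: (u y) (uNy y) => [r| |] // _ cr.
    rewrite -EFinD lte_fin affZ; rewrite lee_fin in cr.
    have hk : `|M - c| / (aff p x / 2) < i.+1%:R.
      apply: lt_le_trans (archi_boundP _) _; first by rewrite divr_ge0 //; lra.
      by rewrite ler_nat (leq_trans ki).
    have h1 : `|M - c| < i.+1%:R * (aff p x / 2) by rewrite -ltr_pdivrMr //; lra.
    have h2 : i.+1%:R * (aff p x / 2) <= i.+1%:R * aff p y by rewrite ler_wpM2l // ltW.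
    have := ler_norm (M - c); lra.
  by rewrite ltry.
move=> x M; have [px|px] := pselect (aff p x = 0); last by rewrite restr_out.
rewrite restr_in // => uM; apply: nearW => i.
by rewrite affZ px mulr0 adde0 ltW.
Qed.

End EpiConvergence.
(** * Density of the maxima of affine functions on cubes *)

Section Density.
Context {R : realType} {n : nat}.
Implicit Types (x y : 'cV[R]_n) (u v : 'cV[R]_n -> \bar R) (a p : 'cV[R]_n * R).

Lemma norm_sq_le_dotv x : `|x| ^+ 2 <= dotv x x.
Proof.
rewrite -[leRHS]sqr_sqrtr ?dotv_ge0 // ler_sqr ?nnegrE ?sqrtr_ge0 //.
exact: norm_le_enorm.
Qed.

Lemma dotv_sqrD x y : dotv (x + y) (x + y) = dotv x x + 2 * dotv x y + dotv y y.
Proof. by rewrite dotvDl !dotvDr (dotvC y x); ring. Qed.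

(** A minimizer of [u + c |. - x0|^2] carries a subgradient of [u], read off
    from the gradient of the quadratic term. *)
Lemma penalized_minimizer_subgradient u x0 y1 (c r : R) : econvex u -> 0 <= c ->
  u y1 = r%:E ->
  (forall y, (u y1 + (c * dotv (y1 - x0) (y1 - x0))%:E <=
              u y + (c * dotv (y - x0) (y - x0))%:E)%E) ->
  forall y, ((r + dotv (2 * c *: (x0 - y1)) (y - y1))%:E <= u y)%E.
Proof.
move=> cu c0 ur ymin y; apply: lee_EFinP => s us; have {}us := ltW us; rewrite lee_fin.
set Q := dotv (y - y1) (y - y1); set P := dotv (y1 - x0) (y - y1).
have Q0 : 0 <= Q := dotv_ge0 _.
have -> : dotv (2 * c *: (x0 - y1)) (y - y1) = - (2 * c * P).
  by rewrite dotvZl -(opprB y1 x0) dotvNl mulrN.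
have key t : 0 < t -> t <= 1 -> 0 <= (s - r + 2 * c * P) + c * t * Q.
  move=> t0 t1; have t01 : 0 <= t <= 1 by rewrite ltW.
  have := econvex_le cu t01 us (_ : (u y1 <= r%:E)%E); rewrite ur => /(_ (lexx _)) h.
  have e : t *: y + (1 - t) *: y1 - x0 = (y1 - x0) + t *: (y - y1).
    by apply/matrixP => i j; rewrite !mxE; ring.
  have := le_trans (ymin _) (leeD2r _ h).
  rewrite ur e -!EFinD lee_fin (dotv_sqrD (y1 - x0)) dotvZl !dotvZr -/Q -/P => h2.
  have : 0 <= t * ((s - r + 2 * c * P) + c * t * Q) by lra.
  by rewrite pmulr_rge0.
rewrite -subr_ge0 leNgt; apply/negP => neg.
set E := s - r + 2 * c * P in key.
have E0 : E < 0 by rewrite /E; lra.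
(* A step small enough for the linear term to dominate the quadratic one. *)
pose t := - E / (- E + c * Q + 1).
have cQ : 0 <= c * Q by exact: mulr_ge0.
have d0 : 0 < - E + c * Q + 1 by lra.
have t0 : 0 < t by rewrite divr_gt0 //; lra.
have t1 : t <= 1 by rewrite ler_pdivrMr //; lra.
have := key t t0 t1.
have : t * (- E + c * Q + 1) = - E by rewrite divfK // gt_eqF.
have : 0 < t * (- E + 1) by rewrite mulr_gt0 //; lra.
by nra.
Qed.

(** For a steep penalty the minimizer [y1] of [u + c |. - x0|^2] is either close
    to [x0], where [u] exceeds [M] by lower semicontinuity, or so far away that
    the quadratic term alone lifts the supporting hyperplane at [y1] above [M]
    over the point [x0]. *)
Lemma affine_minorant u x0 (M : R) : Conv_sc u -> (M%:E < u x0)%E ->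
  exists a, M < aff a x0 /\ forall y, ((aff a y)%:E <= u y)%E.
Proof.
move=> cu Mu; have [uNy [z uz] eu lu _] := cu.
have [m Hm] : exists m : R, forall x, (m%:E <= u x)%E.
  have [B HB] := Conv_sc_coercive setT cu 0; exists (- B) => x.
  by have := HB x I; rewrite mul0r sub0r.
have [d d0 Hd] : exists2 d : R, 0 < d & forall y, `|x0 - y| < d -> (M%:E < u y)%E.
  have /nbhs_ballP[d d0 Hd] := lscP lu Mu; exists d => // y h.
  by apply: Hd; rewrite -ball_normE.
pose c := (`|M - m| + 1) / d ^+ 2.
have c0 : 0 < c by rewrite divr_gt0 ?exprn_gt0 // ltr_wpDl.
pose v y := (u y + (c * dotv (y - x0) (y - x0))%:E)%E.
have uv y : (u y <= v y)%E.
  rewrite /v; case: (u y) => [r| |] //.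
  by rewrite -EFinD lee_fin lerDl mulr_ge0 ?dotv_ge0 // ltW.
have [y1 Hy1] : exists y, forall x, (v y <= v x)%E.
  apply: coercive_minimizer.
  - move=> A; have [B HB] := Conv_sc_coercive setT cu A; exists B => x _.
    by apply: le_trans (uv x); exact: HB.
  - by exists z; rewrite /v; move: uz; case: (u z).
  - move=> x b bv.
    (* The tangent at [x] of the quadratic term reduces lower semicontinuity to
       that of an affine perturbation of [u]. *)
    pose p : 'cV[R]_n * R := (2 * c *: (x - x0),
      c * (- (2 * dotv (x - x0) x0) - dotv (x - x0) (x - x0))).
    have pE y : c * dotv (y - x0) (y - x0) =
                aff p y + c * dotv (y - x) (y - x).
      have -> : y - x0 = (y - x) + (x - x0) by rewrite addrA subrK.
      rewrite dotv_sqrD /aff /p /= dotvZl !(dotvBl, dotvBr).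
      by rewrite (dotvC x0 x) (dotvC x0 y) (dotvC x y); ring.
    have [_ _ _ lw _] := Conv_sc_add_aff p cu.
    have := lw x b; rewrite /v pE subrr dotv0r mulr0 addr0 in bv * => /(_ bv)[W xW HW].
    exists W => // y /HW h; apply: lt_le_trans h _.
    case: (u y) => [r| |] //; rewrite /= ?leey // -!EFinD lee_fin pE lerD2l lerDl.
    by rewrite mulr_ge0 ?dotv_ge0 // ltW.
have [r ur] : exists r, u y1 = r%:E.
  have := Hy1 z; rewrite /v; move: (uNy y1) uz; case: (u y1) => [r| |] // _.
    by exists r.
  by case: (u z) (uNy z).
have sub := penalized_minimizer_subgradient eu (ltW c0) ur Hy1.
set p := 2 * c *: (x0 - y1) in sub.
exists (p, r - dotv p y1); split=> [|y]; last first.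
  by apply: le_trans (sub y); rewrite lee_fin /aff /= dotvBr; lra.
have -> : aff (p, r - dotv p y1) x0 = r + 2 * (c * dotv (x0 - y1) (x0 - y1)).
  by rewrite /aff /= addrCA -dotvBr /p dotvZl; ring.
have q0 := dotv_ge0 (x0 - y1); have [near|far] := ltP `|x0 - y1| d.
  have := Hd _ near; rewrite ur lte_fin => Mr.
  by have := mulr_ge0 (ltW c0) q0; lra.
have : d ^+ 2 <= dotv (x0 - y1) (x0 - y1).
  apply: le_trans (norm_sq_le_dotv _).
  by rewrite ler_sqr ?nnegrE // ltW.
rewrite -(ler_pM2l c0) {1}/c divfK ?gt_eqF ?exprn_gt0 // => h.
have := Hm y1; rewrite ur lee_fin => mr; have := ler_norm (M - m).
have := normr_ge0 (M - m); lra.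
Qed.

(** The contact point is a minimizer of [u] minus the linear function. *)
Lemma best_affine_minorant u (p : 'cV[R]_n) : Conv_sc u ->
  exists m : R, (forall x, ((aff (p, m) x)%:E <= u x)%E) /\
    exists y, u y = (aff (p, m) y)%:E.
Proof.
move=> cu; have cv := Conv_sc_add_aff (- p, 0) cu.
have [y Hy] := Conv_sc_minimizer cv.
have [vNy [z vz] _ _ _] := cv.
have e x : aff (- p, 0) x = - dotv p x by rewrite /aff /= dotvNl addr0.
have [m mE] : exists m : R, (u y + (aff (- p, 0) y)%:E = m%:E)%E.
  have := Hy z; have := vNy y; case: (_ + _)%E => [m| |] // _; first by exists m.
  by rewrite leye_eq (negbTE vz).
exists m; split=> [x|].
  have := Hy x; rewrite mE e /aff /=; case: (u x) => [r| |] //; rewrite ?leey //.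
  by rewrite -EFinD !lee_fin; lra.
exists y; move: mE; rewrite e /aff /=; case: (u y) => [r| |] //.
by rewrite -EFinD => -[<-]; congr EFin; ring.
Qed.

(** The intercept of the best affine minorant depends upper-continuously on
    the slope; super-coercivity confines the contact points to a ball. *)
Lemma best_affine_minorant_stable u (m : 'cV[R]_n -> R) (p x0 : 'cV[R]_n) (M : R) :
  Conv_sc u ->
  (forall q, (forall x, ((aff (q, m q) x)%:E <= u x)%E) /\
    exists y, u y = (aff (q, m q) y)%:E) ->
  M < aff (p, m p) x0 ->
  exists2 e : R, 0 < e & forall q, `|q - p| <= e -> M < aff (q, m q) x0.
Proof.
move=> cu Hm Mp; have [B HB] := Conv_sc_coercive setT cu (n%:R * (`|p| + 1) + 1).
(* Outside of the ball of radius [r] the coercivity estimate for slopes at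
   distance at most one from [p] already gives the intercept [m p]. *)
pose r := `|m p + B|; pose K := n%:R * (r + `|x0|) + 1.
have r0 : 0 <= r := normr_ge0 _.
have K0 : 0 < K by rewrite ltr_wpDl // mulr_ge0 // addr_ge0.
pose e := Num.min 1 ((aff (p, m p) x0 - M) / (2 * K)).
have e0 : 0 < e by rewrite lt_min ltr01 divr_gt0 //; lra.
exists e => // q qp.
have qp1 : `|q - p| <= 1 by rewrite (le_trans qp) // ge_min lexx.
have eK : e * K < aff (p, m p) x0 - M.
  apply: (@le_lt_trans _ _ ((aff (p, m p) x0 - M) / (2 * K) * K)).
    by rewrite ler_wpM2r ?(ltW K0) // ge_min lexx orbT.
  rewrite invfM mulrA divfK ?gt_eqF //; lra.
have dq z : - (n%:R * e * `|z|) <= dotv (q - p) z.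
  rewrite lerNl -dotvNl (le_trans (ler_norm _)) // (le_trans (dotv_le_norm _ _)) //.
  by rewrite ler_wpM2r // ler_wpM2l // normrN.
have dq' z : dotv (q - p) z <= n%:R * e * `|z|.
  by have := dq (- z); rewrite dotvNr normrN lerN2.
suff mq : m p - n%:R * e * r <= m q.
  have -> : aff (q, m q) x0 = aff (p, m p) x0 + dotv (q - p) x0 + (m q - m p).
    by rewrite /aff /= dotvBl; ring.
  have := dq x0; move: eK; rewrite /K; move: mq; lra.
have [y uy] := (Hm q).2.
have yqp : dotv q y = dotv p y + dotv (q - p) y by rewrite dotvBl; ring.
have [yr|ry] := leP `|y| r.
  have := (Hm p).1 y; rewrite uy lee_fin /aff /= yqp => h.
  have := dq' y; have : n%:R * e * `|y| <= n%:R * e * r.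
    by rewrite ler_wpM2l // mulr_ge0 // ltW.
  by lra.
have := HB y I; rewrite uy lee_fin /aff /= => h.
have qn : `|q| <= `|p| + 1.
  by rewrite -[q](subrKC p) (le_trans (ler_normD _ _)) // lerD2l.
have h1 := le_trans (ler_norm _) (dotv_le_norm q y).
have h2 : n%:R * `|q| * `|y| <= n%:R * (`|p| + 1) * `|y|.
  by rewrite ler_wpM2r // ler_wpM2l.
have h3 := ler_norm (m p + B).
have h4 : 0 <= n%:R * e * r by rewrite !mulr_ge0 // ltW.
by rewrite -/r in h3; lra.
Qed.

Lemma dense_sequence : exists q : nat -> 'cV[R]_n,
  forall (p : 'cV[R]_n) (e : R), 0 < e -> exists k, `|q k - p| <= e.
Proof.
exists (fun k => if @unpickle 'cV[rat]_n k is Some v then map_mx ratr v else 0) => p e e0.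
have H i : exists r : rat, `|ratr r - p i 0| <= e.
  have [|r] := @rat_in_itvoo R (p i 0) (p i 0 + e); first by rewrite ltrDl.
  rewrite in_itv /= => /andP[h1 h2]; exists r; rewrite ler_norml; apply/andP.
  by split; lra.
have [f Hf] := choice H.
exists (pickle (\col_i f i : 'cV[rat]_n)); rewrite pickleK.
by apply: norm_le_coord => [|i]; [exact: ltW | rewrite !mxE].
Qed.

(** The first function is kept apart so that the maximum is taken over a
    nonempty list, and is real-valued. *)
Definition maxaff a (s : seq ('cV[R]_n * R)) x : R :=
  foldr (fun p r => Num.max (aff p x) r) (aff a x) s.

Lemma maxaff_le a s x (r : R) :
  (maxaff a s x <= r) = all (fun p => aff p x <= r) (a :: s).
Proof.
elim: s => [|b s IH] /=; first by rewrite andbT.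
by rewrite ge_max IH /= andbCA.
Qed.

Lemma maxaff_ge a s x p : p \in a :: s -> aff p x <= maxaff a s x.
Proof. by move=> ps; have := lexx (maxaff a s x); rewrite maxaff_le => /allP/(_ _ ps). Qed.

Lemma maxaff_convex a s x y (t : R) : 0 <= t <= 1 ->
  maxaff a s (t *: x + (1 - t) *: y) <= t * maxaff a s x + (1 - t) * maxaff a s y.
Proof.
move=> /andP[t0 t1]; rewrite maxaff_le; apply/allP => p ps.
by rewrite aff_convex lerD // ler_wpM2l ?maxaff_ge // subr_ge0.
Qed.

Lemma maxaff_near_gt a s x (c : R) : c < maxaff a s x ->
  \forall y \near x, c < maxaff a s y.
Proof.
elim: s => [|b s IH] /=; first exact: near_aff_gt.
rewrite lt_max => /orP[/near_aff_gt|/IH]; apply: filterS => y h.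
  by rewrite lt_max h.
by rewrite lt_max h orbT.
Qed.

Definition cube (N : R) : set 'cV[R]_n := [set x | `|x| <= N].

Lemma closed_cube N : closed (cube N).
Proof.
apply: (@closed_comp _ _ (fun y : 'cV[R]_n => `|y|) [set t | t <= N]) => [y _|].
  have FF := nbhs_filter y.
  by apply: cvg_norm; exact: cvg_id.
exact: closed_le.
Qed.

Lemma convex_cube N : convex_set (cube N).
Proof.
move=> x y t /= xN yN /andP[t0 t1]; rewrite /cube /= (le_trans (ler_normD _ _)) //.
have s0 : 0 <= 1 - t by rewrite subr_ge0.
rewrite !normrZ (ger0_norm t0) (ger0_norm s0).
have := ler_wpM2l t0 xN; have := ler_wpM2l s0 yN; lra.
Qed.

Lemma Conv_sc_maxaff D a s N : closed D -> convex_set D -> D !=set0 ->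
  D `<=` cube N -> Conv_sc (restr D (fun x => (maxaff a s x)%:E)).
Proof.
move=> clD cD [x0 Dx0] DN; apply: Conv_sc_restr => //.
- by apply: econvexP => // x y t b c t01; rewrite !lee_fin => hb hc;
    rewrite (le_trans (maxaff_convex _ _ _ _ t01)) //; have /andP[t0 t1] := t01;
    rewrite lerD // ler_wpM2l // subr_ge0.
- move=> x b; rewrite lte_fin => /maxaff_near_gt h.
  by exists [set y | b < maxaff a s y].
- move=> A; exists (`|A| * `|N| + (n%:R * `|a.1| * `|N| - a.2)) => x /DN xN.
  have {}xN : `|x| <= `|N| by rewrite (le_trans xN) // ler_norm.
  rewrite lee_fin (le_trans _ (maxaff_ge _ (mem_head _ _))) // /aff.
  have h1 : A * `|x| <= `|A| * `|N|.
    by rewrite (le_trans (ler_wpM2r _ (ler_norm A))) // ler_wpM2l.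
  have h2 := le_trans (ler_norm _) (dotv_le_norm a.1 (- x)).
  have h3 : n%:R * `|a.1| * `|x| <= n%:R * `|a.1| * `|N|.
    by rewrite ler_wpM2l // mulr_ge0.
  by rewrite dotvNr normrN in h2; lra.
- by exists x0.
Qed.

(** The approximations are the best affine minorants for ever more slopes out
    of a dense sequence, on ever larger cubes. Stability of the intercepts lets
    them come arbitrarily close to [u]. *)
Lemma maxaff_dense u : Conv_sc u -> exists us : nat -> 'cV[R]_n -> \bar R,
  [/\ forall i, Conv_sc (us i),
      forall i, exists a s N, us i = restr (cube N) (fun x => (maxaff a s x)%:E) &
      epi_converges us u].
Proof.
move=> cu; have [m Hm] := choice (fun q => @best_affine_minorant u q cu).
have [q Hq] := dense_sequence.
pose f k : 'cV[R]_n * R := (q k, m (q k)).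
pose us i := restr (cube i%:R) (fun x => (maxaff (f 0%N) (map f (iota 1 i)) x)%:E).
have fi k i : (k <= i)%N -> f k \in f 0%N :: map f (iota 1 i).
  by move=> ki; rewrite -map_cons map_f // -/(iota 0 i.+1) mem_iota.
exists us; split.
- move=> i; apply: (@Conv_sc_maxaff _ _ _ i%:R) => //.
  + exact: closed_cube.
  + exact: convex_cube.
  + by exists 0; rewrite /cube /= normr0.
- by move=> i; exists (f 0%N), (map f (iota 1 i)), i%:R.
have [uNy _ _ _ _] := cu.
apply: epi_converges_pointwise => //.
  move=> x M /(affine_minorant cu)[[p b] [Mp pu]].
  have bm : b <= m p.
    have [y uy] := (Hm p).2; have := pu y.
    by rewrite uy lee_fin /aff /= lerD2l.
  have {Mp bm} Mp : M < aff (p, m p) x.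
    by rewrite (lt_le_trans Mp) // /aff /= lerD2l.
  have [e e0 He] := best_affine_minorant_stable cu Hm Mp.
  have [k /He Mk] := Hq p e e0.
  exists ([set y | M < aff (f k) y], [set i | (k <= i)%N]) => /=.
    by split; [exact: near_aff_gt | exact: nbhs_infty_ge].
  move=> [y i] /= [My ki]; apply: lt_le_trans (le_restr _ _ _).
  by rewrite lte_fin (lt_le_trans My) // maxaff_ge // fi.
move=> x M uM; exists (Num.bound `|x|) => // i /= xi.
rewrite /us restr_in; last first.
  by rewrite /cube /= (le_trans (ltW (archi_boundP _))) // ler_nat.
apply: le_trans (ltW uM).
have [r ur] : exists r, u x = r%:E by move: uM (uNy x); case: (u x) => // r; exists r.
rewrite ur lee_fin maxaff_le; apply/allP => p.
have pf k : aff (f k) x <= r by have := (Hm (q k)).1 x; rewrite ur lee_fin.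
by rewrite inE => /orP[/eqP ->|/mapP[k _ ->]].
Qed.

End Density.
(** * Functionals with the symmetries of the problem *)

Section Functionals.
Context {R : realType} {n : nat}.
Implicit Types (x y a d : 'cV[R]_n) (u v : 'cV[R]_n -> \bar R) (p g : 'cV[R]_n * R).

(** Both sides are determinants of products of block matrices, obtained from
    one matrix of size [1 + n] by eliminating either block. *)
Lemma det_1Drank1 d a : \det (1%:M + d *m a^T) = 1 + dotv a d.
Proof.
pose L := block_mx (1%:M : 'M[R]_1) 0 d 1%:M.
have e : L *m block_mx 1%:M (- a^T) 0 (1%:M + d *m a^T) =
         block_mx (1%:M + a^T *m d) (- a^T) 0 1%:M *m L.
  rewrite !mulmx_block !(mul1mx, mulmx1, mul0mx, mulmx0, addr0, add0r).
  congr block_mx; first by rewrite mulNmx addrK.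
  by rewrite mulmxN addrCA addNr addr0.
have := congr1 determinant e; rewrite !det_mulmx !(det_ublock, det_lblock) !det1 !mul1r !mulr1.
by rewrite det_mx11 !mxE eqxx mulr1n => ->; congr (1 + _); apply: eq_bigr => i _; rewrite mxE.
Qed.

Lemma mulmx_rank1 d a x : (d *m a^T) *m x = dotv a x *: d.
Proof.
by rewrite -mulmxA [a^T *m x]mx11_scalar -dotvE mul_mx_scalar.
Qed.

Lemma mul_1Drank1 d a x : (1%:M + d *m a^T) *m x = x + dotv a x *: d.
Proof. by rewrite mulmxDl mul1mx mulmx_rank1. Qed.

(** The properties of the difference between a functional covered by the
    theorem, evaluated at the origin, and the matching multiple of the
    exponential of the minimum: they will turn out to force [z = 0]. *)
Record null_functional (z : ('cV[R]_n -> \bar R) -> R) : Prop := {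
  nf_cvg : forall (us : nat -> 'cV[R]_n -> \bar R) u, (forall i, Conv_sc (us i)) ->
    Conv_sc u -> epi_converges us u -> z (us i) @[i --> \oo] --> z u;
  nf_mulmx : forall u (A : 'M[R]_n), Conv_sc u -> \det A = 1 ->
    z (fun x => u (A *m x)) = z u;
  nf_valuation : forall u v, Conv_sc u -> Conv_sc v ->
    Conv_sc (fun x => maxe (u x) (v x)) -> Conv_sc (fun x => mine (u x) (v x)) ->
    z (fun x => maxe (u x) (v x)) + z (fun x => mine (u x) (v x)) = z u + z v;
  nf_shift : forall u y, Conv_sc u -> z (fun x => u (x + y)) = z u;
  nf_addr : forall u (r : R), Conv_sc u -> z (fun x => u x + r%:E)%E = expR r * z u;
  nf_point : z (restr [set 0] (fun=> 0%E)) = 0 }.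

Lemma Conv_sc_point : Conv_sc (restr [set 0 : 'cV[R]_n] (fun=> 0%E)).
Proof.
have e0 : [set 0 : 'cV[R]_n] = cube 0.
  by apply/seteqP; split=> x /=; rewrite /cube /= normr_le0 => /eqP.
apply: Conv_sc_restr.
- by rewrite e0; exact: closed_cube.
- by rewrite e0; exact: convex_cube.
- by move=> x y t _; rewrite !mule0 adde0.
- by move=> x b b0; exists setT => //; exact: filterT.
- by move=> B; exists 0 => x ->; rewrite normr0 mulr0 subr0.
- by exists 0.
Qed.

Definition half g : set 'cV[R]_n := [set x | aff g x <= 0].

Lemma closed_half g : closed (half g). Proof. exact: closed_aff_le. Qed.

Lemma convex_half g : convex_set (half g). Proof. exact: convex_aff_le. Qed.

Context (z : ('cV[R]_n -> \bar R) -> R) (zP : null_functional z).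

(** Vacuously true outside [Conv_sc], which spares case distinctions when a
    function is cut and one of the pieces is empty. *)
Definition vanish u := Conv_sc u -> z u = 0.

Lemma vanish_limit (us : nat -> 'cV[R]_n -> \bar R) u : (forall i, Conv_sc u -> Conv_sc (us i)) ->
  (forall i, vanish (us i)) -> (Conv_sc u -> epi_converges us u) -> vanish u.
Proof.
move=> cus vus usu cu.
have := nf_cvg zP (cus^~ cu) cu (usu cu).
have -> : (fun i => z (us i)) = (fun=> 0).
  by apply/funext => i; rewrite vus //; exact: cus.
by move=> h; rewrite -(cvg_lim _ h) // lim_cst.
Qed.

Lemma unitmx_det1 (A : 'M[R]_n) : \det A = 1 -> A \in unitmx.
Proof. by rewrite unitmxE => ->; exact: unitr1. Qed.

Lemma nf_shift_addr u y (r : R) : Conv_sc u ->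
  z (fun x => u (x + y)%R + r%:E)%E = expR r * z u.
Proof. by move=> cu; rewrite (nf_addr zP _ (Conv_sc_shift y cu)) (nf_shift zP). Qed.

Lemma Conv_sc_shear u a d : dotv a d = 0 -> Conv_sc u ->
  Conv_sc (fun x => u (x + dotv a x *: d)).
Proof.
move=> ad cu; have -> : (fun x => u (x + dotv a x *: d)) =
    (fun x => u ((1%:M + d *m a^T) *m x)).
  by apply/funext => x; rewrite mulmxDl mul1mx mulmx_rank1.
by apply: Conv_sc_mulmx => //; apply: unitmx_det1; rewrite det_1Drank1 ad addr0.
Qed.

Lemma nf_shear u a d : dotv a d = 0 -> Conv_sc u ->
  z (fun x => u (x + dotv a x *: d)) = z u.
Proof.
move=> ad cu; have -> : (fun x => u (x + dotv a x *: d)) =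
    (fun x => u ((1%:M + d *m a^T) *m x)).
  by apply/funext => x; rewrite mulmxDl mul1mx mulmx_rank1.
by apply: nf_mulmx => //; rewrite det_1Drank1 ad addr0.
Qed.

Lemma affine_shearE g d x : dotv g.1 d = 0 ->
  x + aff g x *: d = (x + g.2 *: d) + dotv g.1 (x + g.2 *: d) *: d.
Proof.
move=> gd; rewrite dotvDr dotvZr gd mulr0 addr0 /aff scalerDl -!addrA.
by congr (_ + _); exact: addrC.
Qed.

Lemma Conv_sc_affine_shear u g d : dotv g.1 d = 0 -> Conv_sc u ->
  Conv_sc (fun x => u (x + aff g x *: d)).
Proof.
move=> gd cu; under eq_fun do rewrite affine_shearE //.
exact: (Conv_sc_shift (g.2 *: d) (Conv_sc_shear gd cu)).
Qed.

Lemma nf_affine_shear u g d : dotv g.1 d = 0 -> Conv_sc u ->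
  z (fun x => u (x + aff g x *: d)) = z u.
Proof.
move=> gd cu; under eq_fun do rewrite affine_shearE //.
by rewrite (nf_shift zP (g.2 *: d) (Conv_sc_shear gd cu)) nf_shear.
Qed.

Lemma vanish_affine_shear u g d : dotv g.1 d = 0 -> vanish u ->
  vanish (fun x => u (x + aff g x *: d)).
Proof.
move=> gd vu cu; have gd' : dotv (- g).1 d = 0 by rewrite dotvNl gd oppr0.
have cu' := Conv_sc_affine_shear gd' cu.
have e : (fun x => u (x + aff (- g) x *: d + aff g (x + aff (- g) x *: d) *: d)) = u.
  apply/funext => x; congr u.
  by rewrite aff_addr dotvZr gd mulr0 addr0 affN scaleNr subrK.
by rewrite e in cu'; rewrite (nf_affine_shear gd cu') vu.
Qed.

(** ** Functions supported in a hyperplane *)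

(** On a hyperplane the dilations are restrictions of unimodular maps, so
    [z u] does not change when the graph of [u] is shrunk horizontally to the
    single point [(0, min u)]. *)
Lemma vanish_flat0 u a : a != 0 -> (forall x, u x != +oo%E -> dotv a x = 0) -> vanish u.
Proof.
move=> a0 ua cu; have [uNy [x0 ux0] _ _ _] := cu.
have aa : dotv a a != 0.
  rewrite gt_eqF // (lt_le_trans _ (norm_sq_le_dotv a)) //.
  by rewrite exprn_gt0 // normr_gt0.
pose s (i : nat) : R := i.+1%:R; have s0 i : s i != 0 by rewrite pnatr_eq0.
(* Dilation by [s i] on the hyperplane; the factor in the direction of [a]
   makes the determinant equal to one. *)
pose A i : 'M[R]_n := s i *: (1%:M + ((s i ^- n - 1) / dotv a a) *: a *m a^T).
have dA i : \det (A i) = 1.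
  by rewrite detZ det_1Drank1 dotvZr divfK // subrKC mulfV // expf_neq0.
have AE i x : A i *m x = s i *: x + (s i * ((s i ^- n - 1) / dotv a a) * dotv a x) *: a.
  rewrite /A -scalemxAl mulmxDl mul1mx mulmx_rank1 scalerDr !scalerA.
  by congr (_ + _ *: _); ring.
have uA i : (fun x => u (A i *m x)) = (fun x => u (s i *: x)).
  apply/funext => x; rewrite AE; have [->|ax] := eqVneq (dotv a x) 0.
    by rewrite mulr0 scale0r addr0.
  have h c : c != 0 -> forall y, dotv a y = c -> u y = +oo%E.
    by move=> c0 y yc; apply/eqP; apply: contraNT c0 => /ua; rewrite yc => /eqP.
  rewrite [RHS](h (s i * dotv a x)) ?mulf_neq0 ?dotvZr //.
  rewrite (h (s i ^- n * s i * dotv a x)) ?mulf_neq0 ?invr_eq0 ?expf_neq0 //.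
  have := divfK aa (s i ^- n - 1); rewrite dotvDr !dotvZr; set w := _ / dotv a a => e.
  have -> : s i ^- n = w * dotv a a + 1 by rewrite e subrK.
  by ring.
have [y0 Hy0] := Conv_sc_minimizer cu.
have [m um] : exists m, u y0 = m%:E.
  have := Hy0 x0; move: (uNy y0) (uNy x0) ux0; case: (u y0) => [m| |] //; first by exists m.
  by case: (u x0).
have mu x : (m%:E <= u x)%E by rewrite -um.
pose o : 'cV[R]_n -> \bar R := restr [set 0] (fun=> 0%E).
have co : Conv_sc o := Conv_sc_point.
have com := Conv_sc_add_aff (0, m) co.
have omE : (fun x => o x + (aff (0, m) x)%:E)%E = (fun x => o x + m%:E)%E.
  by apply/funext => x; rewrite /aff /= dotv0l add0r.
rewrite omE in com.
have cA i : Conv_sc (fun x => u (s i *: x)).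
  by rewrite -uA; exact: (Conv_sc_mulmx (unitmx_det1 (dA i)) cu).
have ep : epi_converges (fun i x => u (s i *: x)) (fun x => o x + m%:E)%E.
  apply: epi_convergesI.
  - by move=> x; rewrite /o /restr; case: ifP.
  - move=> x M; have [->|xn0] := eqVneq x 0.
      rewrite /o restr_in // add0e => Mm.
      exists (setT, setT); first by split; exact: filterT.
      by move=> [y i] _; exact: lt_le_trans (mu _).
    move=> _; have [B HB] := Conv_sc_coercive setT cu 1.
    have nx : 0 < `|x| by rewrite normr_gt0.
    have nx2 : 0 < `|x| / 2 by rewrite divr_gt0.
    pose k := Num.bound (`|M + B| / (`|x| / 2)).
    exists ([set y | `|x - y| <= `|x| / 2], [set i | (k <= i)%N]) => /=.
      by split; [exact: near_dist_le | exact: nbhs_infty_ge].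
    move=> [y i] /= [xy ki]; apply: lt_le_trans (HB _ I).
    rewrite lte_fin mul1r normrZ ger0_norm // ltrBrDr.
    have hy : `|x| / 2 <= `|y|.
      by have := lerB_normD x (- y); rewrite normrN; move: xy; lra.
    have hk : `|M + B| < s i * (`|x| / 2).
      rewrite -ltr_pdivrMr // (lt_le_trans (archi_boundP _)) ?divr_ge0 ?(ltW nx2) //.
      by rewrite ler_nat (leq_trans ki).
    rewrite (le_lt_trans (ler_norm _)) // (lt_le_trans hk) //.
    by rewrite ler_wpM2l.
  - move=> x; have [->|xn0] := eqVneq x 0; last first.
      exists (fun=> x); first exact: cvg_cst.
      by move=> M; rewrite /o restr_out //; apply/eqP.
    exists (fun i => (s i)^-1 *: y0).
      rewrite -[X in _ --> X](scale0r y0); apply: cvgZl.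
      exact: cvg_harmonic.
    move=> M; rewrite /o restr_in // add0e => mM; apply: nearW => i.
    by rewrite scalerA mulfV // scale1r um ltW.
have := nf_cvg zP cA com ep.
have -> : (fun i => z (fun x => u (s i *: x))) = (fun=> z u).
  by apply/funext => i; rewrite -uA (nf_mulmx zP cu (dA i)).
rewrite (nf_addr zP _ co) (nf_point zP) mulr0 => h.
by rewrite -[RHS](cvg_lim _ h) // lim_cst.
Qed.

Lemma vanish_flat u g : g.1 != 0 -> (forall x, u x != +oo%E -> aff g x = 0) -> vanish u.
Proof.
move=> g0 ug cu; have [_ [x0 ux0] _ _ _] := cu.
rewrite -(nf_shift zP x0 cu); apply: (vanish_flat0 g0) (Conv_sc_shift _ cu).
move=> x /ug; have := ug _ ux0; rewrite addrC aff_addr; lra.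
Qed.

(** ** Cutting along hyperplanes *)

(** The pointwise minimum of the two pieces is [u], and their maximum is
    supported in the hyperplane. *)
Lemma cut_eq u g : Conv_sc u -> g.1 != 0 ->
  (exists x, u x != +oo%E /\ aff g x = 0) ->
  z u = z (restr (half g) u) + z (restr (half (- g)) u).
Proof.
move=> cu g0 [x0 [ux0 gx0]].
have c1 : Conv_sc (restr (half g) u).
  apply: Conv_sc_restrI => //; [exact: closed_half | exact: convex_half |].
  by exists x0; rewrite /half /= gx0.
have c2 : Conv_sc (restr (half (- g)) u).
  apply: Conv_sc_restrI => //; [exact: closed_half | exact: convex_half |].
  by exists x0; rewrite /half /= affN gx0 oppr0.
have emin : (fun x => mine (restr (half g) u x) (restr (half (- g)) u x)) = u.
  apply/funext => x; have [gx|gx] := leP (aff g x) 0.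
    by rewrite restr_in // min_l // le_restr.
  by rewrite [X in mine _ X]restr_in /half /= ?affN ?oppr_le0 ?(ltW gx) // min_r // le_restr.
have emax : (fun x => maxe (restr (half g) u x) (restr (half (- g)) u x)) =
    restr (half g `&` half (- g)) u.
  apply/funext => x; rewrite -restr_restr.
  have [gx|gx] := pselect (half g x).
    by rewrite !(restr_in _ gx) max_r // le_restr.
  by rewrite !(restr_out _ gx) max_l // leey.
have c3 : Conv_sc (restr (half g `&` half (- g)) u).
  apply: Conv_sc_restrI => //.
  - by apply: closedI; exact: closed_half.
  - by apply: convex_setI; exact: convex_half.
  by exists x0; rewrite /half /= affN gx0 oppr0.
have := nf_valuation zP c1 c2; rewrite emin emax => /(_ c3 cu) <-.
rewrite (vanish_flat g0 _ c3) ?add0r // => x /restr_proper[[+ +] _].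
by rewrite /half /= affN; lra.
Qed.

(** If the hyperplane misses the domain of [u], then by convexity the domain
    lies on one side, and [u] is equal to one of the pieces. *)
Lemma cut_vanish u g :
  vanish (restr (half g) u) -> vanish (restr (half (- g)) u) -> vanish u.
Proof.
move=> v1 v2 cu; have [uNy _ eu _ _] := cu.
have side h : (forall x, u x != +oo%E -> aff h x <= 0) ->
    vanish (restr (half h) u) -> z u = 0.
  move=> hu; have -> : restr (half h) u = u; last exact.
  apply/funext => x; have [hx|hx] := pselect (half h x).
    by rewrite restr_in.
  by rewrite restr_out //; apply/esym/eqP; apply: contrapT => /negP /hu.
have [g0|g0] := eqVneq g.1 0.
  have gE x : aff g x = g.2 by rewrite /aff g0 dotv0l add0r.
  have [g2|g2] := leP g.2 0.
    by apply: side v1 => x _; rewrite gE.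
  by apply: side v2 => x _; rewrite affN gE oppr_le0 ltW.
have [hit|miss] := pselect (exists x, u x != +oo%E /\ aff g x = 0).
  have [x0 [ux0 gx0]] := hit.
  rewrite (cut_eq cu g0 hit) v1 ?v2 ?addr0 //.
    apply: Conv_sc_restrI => //; [exact: closed_half | exact: convex_half |].
    by exists x0; rewrite /half /= affN gx0 oppr0.
  apply: Conv_sc_restrI => //; [exact: closed_half | exact: convex_half |].
  by exists x0; rewrite /half /= gx0.
have [neg|/existsNP[x /not_implyP[ux /negP]]] :=
    pselect (forall x, u x != +oo%E -> aff g x <= 0).
  exact: side v1.
rewrite -ltNge => gx.
(* A segment in the domain cannot change sides without meeting the hyperplane. *)
have pos y : u y != +oo%E -> aff (- g) y <= 0.
  move=> uy; rewrite affN oppr_le0 leNgt; apply/negP => gy; apply: miss.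
  pose t := aff g x / (aff g x - aff g y).
  have d0 : 0 < aff g x - aff g y by lra.
  have t01 : 0 <= t <= 1.
    apply/andP; split; first by rewrite divr_ge0 // ltW.
    by rewrite ler_pdivrMr //; lra.
  have [ry ury] : exists r, u y = r%:E by move: uy (uNy y); case: (u y) => // r; exists r.
  have [rx urx] : exists r, u x = r%:E by move: ux (uNy x); case: (u x) => // r; exists r.
  exists (t *: y + (1 - t) *: x); split.
    have := econvex_le eu t01 (_ : (u y <= ry%:E)%E) (_ : (u x <= rx%:E)%E).
    rewrite ury urx !lexx => /(_ isT isT).
    by case: (u _).
  rewrite aff_convex; have : t * (aff g x - aff g y) = aff g x by rewrite divfK // gt_eqF.
  by lra.
exact: side v2.
Qed.

End Functionals.
(** * Affine functions on products with a rectangle *)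

Section Rectangles.
Context {R : realType} {n : nat}.
Implicit Types (x y : 'cV[R]_n) (p q : 'cV[R]_n * R) (B D : set 'cV[R]_n) (i j : 'I_n).

Lemma Conv_sc_aff D p N : closed D -> convex_set D -> D !=set0 ->
  D `<=` cube N -> Conv_sc (restr D (fun x => (aff p x)%:E)).
Proof. exact: (@Conv_sc_maxaff _ _ D p [::] N). Qed.

Lemma Conv_sc_aff_bounded D p : Conv_sc (restr D (fun x => (aff p x)%:E)) ->
  exists N, D `<=` cube N.
Proof.
move=> cu; have [B HB] := Conv_sc_coercive setT cu (n%:R * `|p.1| + 1).
exists (p.2 + B) => x Dx; have := HB x I; rewrite restr_in // lee_fin /aff => h.
have := le_trans (ler_norm _) (dotv_le_norm p.1 x).
by rewrite /cube /=; lra.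
Qed.

Lemma Conv_sc_aff_nonempty D p : Conv_sc (restr D (fun x => (aff p x)%:E)) -> D !=set0.
Proof. by move=> [_ [x /restr_proper[Dx _]] _ _ _]; exists x. Qed.

Lemma aff_evec i (c : R) x : aff (evec i, c) x = x i 0 + c.
Proof. by rewrite /aff /= dotvC dotv_evec. Qed.

Lemma evec_neq0 i : evec i != 0 :> 'cV[R]_n.
Proof.
apply/eqP => /matrixP/(_ i 0); rewrite evecE eqxx mxE => /eqP.
by rewrite oner_eq0.
Qed.

Lemma coord_addZevec x (t : R) i j : (x + t *: evec j) i 0 = x i 0 + t * (i == j)%:R.
Proof. by rewrite mxE [X in _ + X]mxE evecE. Qed.

Lemma coord_addZevec_id x (t : R) i : (x + t *: evec i) i 0 = x i 0 + t.
Proof. by rewrite coord_addZevec eqxx mulr1. Qed.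

Lemma coord_addZevec_neq x (t : R) i j : i != j -> (x + t *: evec j) i 0 = x i 0.
Proof. by move=> /negbTE h; rewrite coord_addZevec h mulr0 addr0. Qed.

Lemma dotv_evecl x i : dotv (evec i) x = x i 0.
Proof. by rewrite dotvC dotv_evec. Qed.

Definition invariant i B := forall x (t : R), B x -> B (x + t *: evec i).

Lemma invariantE i B x (t : R) : invariant i B -> B (x + t *: evec i) <-> B x.
Proof.
move=> iB; split=> [h|]; last exact: iB.
by have := iB _ (- t) h; rewrite scaleNr addrK.
Qed.

Definition rect i j (L M : R) : set 'cV[R]_n :=
  [set x | [/\ 0 <= x i 0, x i 0 <= L, 0 <= x j 0 & x j 0 <= M]].

Lemma rectC i j L M : rect i j L M = rect j i M L.
Proof. by apply/seteqP; split=> x [? ? ? ?]; split. Qed.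

(** Invariance in two directions and boundedness of the base make the
    intersection with [rect i j L M] a compact domain for all [L] and [M]. *)
Record cylinder i j B : Prop := {
  cyl_closed : closed B;
  cyl_convex : convex_set B;
  cyl_inv1 : invariant i B;
  cyl_inv2 : invariant j B;
  cyl_base : exists x, [/\ B x, x i 0 = 0 & x j 0 = 0];
  cyl_bounded : exists N, forall x, B x -> x i 0 = 0 -> x j 0 = 0 -> `|x| <= N }.

Lemma cylinderC i j B : cylinder i j B -> cylinder j i B.
Proof.
move=> [cB vB iB jB [x [Bx xi xj]] [N HN]].
by split=> //; [exists x | exists N => y By yj yi; exact: HN].
Qed.

Lemma closed_coord_le i (c : R) : closed [set x : 'cV[R]_n | x i 0 <= c].
Proof.
have -> : [set x : 'cV[R]_n | x i 0 <= c] = half (evec i, - c).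
  by apply/seteqP; split=> x; rewrite /half /= aff_evec subr_le0.
exact: closed_half.
Qed.

Lemma closed_coord_ge i (c : R) : closed [set x : 'cV[R]_n | c <= x i 0].
Proof.
have -> : [set x : 'cV[R]_n | c <= x i 0] = half (- (evec i, - c)).
  by apply/seteqP; split=> x; rewrite /half /= affN aff_evec opprB subr_le0.
exact: closed_half.
Qed.

Lemma convex_coord_le i (c : R) : convex_set [set x : 'cV[R]_n | x i 0 <= c].
Proof.
move=> x y t /= xc yc /andP[t0 t1]; rewrite !mxE.
have := ler_wpM2l t0 xc; have s0 : 0 <= 1 - t by lra.
by have := ler_wpM2l s0 yc; lra.
Qed.

Lemma convex_coord_ge i (c : R) : convex_set [set x : 'cV[R]_n | c <= x i 0].
Proof.
move=> x y t /= xc yc /andP[t0 t1]; rewrite !mxE.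
have := ler_wpM2l t0 xc; have s0 : 0 <= 1 - t by lra.
by have := ler_wpM2l s0 yc; lra.
Qed.

Lemma rectE i j L M : rect i j L M =
  ([set x | 0 <= x i 0] `&` [set x | x i 0 <= L]) `&`
  ([set x | 0 <= x j 0] `&` [set x | x j 0 <= M]).
Proof. by apply/seteqP; split=> x; [move=> [? ? ? ?] | move=> [[? ?] [? ?]]]. Qed.

Lemma closed_rect i j L M : closed (rect i j L M).
Proof.
by rewrite rectE; apply: closedI; apply: closedI;
  [exact: closed_coord_ge | exact: closed_coord_le |
   exact: closed_coord_ge | exact: closed_coord_le].
Qed.

Lemma convex_rect i j L M : convex_set (rect i j L M).
Proof.
by rewrite rectE; apply: convex_setI; apply: convex_setI;
  [exact: convex_coord_ge | exact: convex_coord_le |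
   exact: convex_coord_ge | exact: convex_coord_le].
Qed.

Lemma norm_evec_le i : `|evec i| <= 1 :> R.
Proof.
apply: norm_le_coord => // k; rewrite evecE.
by case: eqP => _; rewrite ?normr1 ?normr0.
Qed.

(** The two halves of a square cut along its diagonal are [tri i j] and
    [tri j i]. *)
Definition tri i j : set 'cV[R]_n := [set x | x i 0 <= x j 0].

Lemma triE i j : half (evec i - evec j, 0) = tri i j.
Proof.
by apply/seteqP; split=> x; rewrite /half /tri /= /aff /= dotvBl !dotv_evecl addr0 subr_le0.
Qed.

Lemma triNE i j : half (- (evec i - evec j, 0)) = tri j i.
Proof.
rewrite -triE; congr half; congr pair; first exact: opprB.
exact: oppr0.
Qed.

Lemma tri_neq0 i j : i != j -> evec i - evec j != 0 :> 'cV[R]_n.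
Proof.
move=> ij; apply/eqP => /matrixP/(_ i 0); rewrite !mxE !eqxx (negbTE ij) /= subr0 => /eqP.
by rewrite oner_eq0.
Qed.

Section Cylinder.
Context (z : ('cV[R]_n -> \bar R) -> R) (zP : null_functional z).

(** The slopes along [evec i] and [evec j] are singled out; [q] is meant to
    be constant in these two directions. *)
Definition slope i j q (a b : R) : 'cV[R]_n * R :=
  (q.1 + a *: evec i + b *: evec j, q.2).

Lemma aff_slope i j q a b x : aff (slope i j q a b) x = aff q x + a * x i 0 + b * x j 0.
Proof.
rewrite /aff /slope /= !dotvDl !dotvZl !(dotvC (evec _)) !dotv_evec; ring.
Qed.

Lemma slopeC i j q a b : slope i j q a b = slope j i q b a.
Proof. by rewrite /slope addrAC. Qed.

Definition rect_val i j B q (a b L M : R) : R :=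
  z (restr (B `&` rect i j L M) (fun x => (aff (slope i j q a b) x)%:E)).

Definition tri_val i j B q (a b : R) : R :=
  z (restr (B `&` (tri i j `&` rect i j 1 1)) (fun x => (aff (slope i j q a b) x)%:E)).

Lemma rect_valC i j B q a b L M : rect_val i j B q a b L M = rect_val j i B q b a M L.
Proof. by rewrite /rect_val rectC slopeC. Qed.

Lemma nf_squeeze u i j (s : R) : i != j -> s != 0 -> Conv_sc u ->
  z (fun x => u (x + ((s - 1) * x i 0) *: evec i + ((s^-1 - 1) * x j 0) *: evec j)) = z u.
Proof.
move=> ij s0 cu.
pose A : 'M[R]_n := (1%:M + (s - 1) *: evec i *m (evec i)^T) *m
                    (1%:M + (s^-1 - 1) *: evec j *m (evec j)^T).
have dA : \det A = 1.
  rewrite det_mulmx !det_1Drank1 !dotvZr !dotv_evec !evecE !eqxx !mulr1 !subrKC.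
  by rewrite mulfV.
rewrite -[RHS](nf_mulmx zP cu dA); congr z; apply/funext => x; congr u.
rewrite -mulmxA !mul_1Drank1 !dotv_evecl !scalerA coord_addZevec_neq //.
by rewrite [in RHS]addrAC (mulrC (x i 0)) (mulrC (x j 0)).
Qed.

(** A quarter turn is a product of three shears. *)
Lemma nf_rotate u i j : i != j -> Conv_sc u ->
  z (fun x => u (x + (- (x i 0 + x j 0)) *: evec i + (x i 0 - x j 0) *: evec j)) = z u.
Proof.
move=> ij cu; have ji : j != i by rewrite eq_sym.
have oi : dotv (- evec j : 'cV[R]_n) (evec i) = 0.
  by rewrite dotvNl dotv_evec evecE (negbTE ij) oppr0.
have oj : dotv (evec i : 'cV[R]_n) (evec j) = 0.
  by rewrite dotv_evec evecE (negbTE ji).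
have c1 := Conv_sc_shear oi cu; have c2 := Conv_sc_shear oj c1.
rewrite -[RHS](nf_shear zP oi cu) -[RHS](nf_shear zP oj c1) -[RHS](nf_shear zP oi c2).
congr z; apply/funext => x; congr u.
rewrite !(dotvNl, dotv_evecl) !(coord_addZevec_id, coord_addZevec_neq) //.
by apply/matrixP => k l; rewrite !mxE; ring.
Qed.

Context (i j : 'I_n) (ij : i != j) (B : set 'cV[R]_n) (cB : cylinder i j B).
Context (q : 'cV[R]_n * R) (qi : q.1 i 0 = 0) (qj : q.1 j 0 = 0).
Local Notation f := (rect_val i j B q).
Local Notation u_ := (fun D a b => restr (B `&` D) (fun x => (aff (slope i j q a b) x)%:E)).

Let ji : j != i. Proof. by rewrite eq_sym. Qed.
Let iB := cyl_inv1 cB.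
Let jB := cyl_inv2 cB.

Let affq_i x (t : R) : aff q (x + t *: evec i) = aff q x.
Proof. by rewrite aff_addr dotvZr dotv_evec qi mulr0 addr0. Qed.

Let affq_j x (t : R) : aff q (x + t *: evec j) = aff q x.
Proof. by rewrite aff_addr dotvZr dotv_evec qj mulr0 addr0. Qed.

Lemma Conv_sc_sub_rect p D (L M : R) : closed D -> convex_set D -> B `&` D !=set0 ->
  D `<=` rect i j L M -> Conv_sc (restr (B `&` D) (fun x => (aff p x)%:E)).
Proof.
move=> clD cD D0 DL; have [N HN] := cyl_bounded cB.
apply: (@Conv_sc_aff _ _ (N + L + M)) => //.
- by apply: closedI => //; exact: cyl_closed cB.
- by apply: convex_setI => //; exact: cyl_convex cB.
move=> x [Bx /DL[x0 xL y0 yM]].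
pose y := x + (- x i 0) *: evec i + (- x j 0) *: evec j.
have yN : `|y| <= N.
  apply: HN; first by apply: jB; exact: iB.
    by rewrite /y coord_addZevec_neq // coord_addZevec_id subrr.
  by rewrite /y coord_addZevec_id coord_addZevec_neq // subrr.
have -> : x = y + x i 0 *: evec i + x j 0 *: evec j.
  by rewrite /y !scaleNr addrAC subrK subrK.
rewrite /cube /= (le_trans (ler_normD _ _)) // lerD //.
  rewrite (le_trans (ler_normD _ _)) // lerD // normrZ ger0_norm //.
  by rewrite -[leRHS]mulr1 ler_pM // norm_evec_le.
by rewrite normrZ ger0_norm // -[leRHS]mulr1 ler_pM // norm_evec_le.
Qed.

Let point (s t : R) : exists x, [/\ B x, x i 0 = s & x j 0 = t].
Proof.
have [x [Bx xi xj]] := cyl_base cB; exists (x + s *: evec i + t *: evec j); split.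
- by apply: jB; exact: iB.
- by rewrite coord_addZevec_neq // coord_addZevec_id xi add0r.
- by rewrite coord_addZevec_id coord_addZevec_neq // xj add0r.
Qed.

Lemma Conv_sc_rect p (L M : R) : 0 <= L -> 0 <= M ->
  Conv_sc (restr (B `&` rect i j L M) (fun x => (aff p x)%:E)).
Proof.
move=> L0 M0; apply: (@Conv_sc_sub_rect _ _ L M) => //.
- exact: closed_rect.
- exact: convex_rect.
by have [x [Bx xi xj]] := point 0 0; exists x; split=> //; rewrite /rect /= xi xj.
Qed.

(** The upper piece of the rectangle is a translate of a shorter rectangle, and
    the affine function increases by [a * s] under this translation. *)
Lemma rect_val_split a b s t M : 0 <= s -> 0 <= t -> 0 <= M ->
  f a b (s + t) M = f a b s M + expR (a * s) * f a b t M.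
Proof.
move=> s0 t0 M0; have st0 : 0 <= s + t by rewrite addr_ge0.
pose g : 'cV[R]_n * R := (evec i, - s).
have gE x : aff g x = x i 0 - s by rewrite aff_evec.
have hit : exists x, u_ (rect i j (s + t) M) a b x != +oo%E /\ aff g x = 0.
  have [x [Bx xi xj]] := point s 0; exists x; split; last by rewrite gE xi subrr.
  by apply/restr_proper; split=> //; split=> //; split; rewrite ?xi ?xj // lerDl.
have g0 : g.1 != 0 := evec_neq0 i.
rewrite /rect_val (cut_eq zP (Conv_sc_rect _ st0 M0) g0 hit) !restr_restr.
congr (_ + _).
  congr z; apply/funext => x; apply: restr_eq => //.
  rewrite /half /= gE; split=> [[xs [Bx [x0 xst y0 yM]]]|[Bx [x0 xs y0 yM]]].
    by split=> //; split=> //; lra.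
  by repeat split=> //; lra.
have c2 := Conv_sc_rect (slope i j q a b) t0 M0.
rewrite -(nf_shift_addr zP (- s *: evec i) (a * s) c2).
congr z; apply/funext => x.
have [Hx|Hx] := pselect ((half (- g) `&` (B `&` rect i j (s + t) M)) x).
  rewrite restr_in // restr_in.
    rewrite -EFinD !aff_slope affq_i coord_addZevec_id coord_addZevec_neq //; congr EFin; ring.
  move: Hx; rewrite /half /= affN gE => -[xs [Bx [x0 xst y0 yM]]].
  split; first exact: iB.
  by split; rewrite ?coord_addZevec_id ?coord_addZevec_neq //; lra.
rewrite restr_out // restr_out // => -[/invariantE Bx [+ + + +]].
rewrite coord_addZevec_id coord_addZevec_neq // => x0 xt y0 yM; apply: Hx.
rewrite /half /= affN gE; split; first by lra.
by split; [exact: Bx | split; lra].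
Qed.

(** A rectangle of side [L + L'] can be split in two ways; hence the dependence
    on [L] is that of [expR (a * L) - 1]. *)
Lemma rect_val_ratio a b L L' M : 0 <= L -> 0 <= L' -> 0 <= M ->
  f a b L M * (expR (a * L') - 1) = f a b L' M * (expR (a * L) - 1).
Proof.
move=> L0 L0' M0; have := rect_val_split a b L0 L0' M0.
by rewrite addrC rect_val_split //; lra.
Qed.

(** Stretching one side and shrinking the other one by the same factor has
    determinant one. *)
Lemma rect_val_squeeze a b s L M : 0 < s -> 0 <= L -> 0 <= M ->
  f a b L M = f (a * s) (b / s) (L / s) (M * s).
Proof.
move=> s0 L0 M0; have sn0 : s != 0 by rewrite gt_eqF.
rewrite /rect_val -(nf_squeeze ij sn0 (Conv_sc_rect _ L0 M0)) restr_comp.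
congr z; apply/funext => x.
set T := fun _ => _.
have Ti : T x i 0 = s * x i 0.
  by rewrite /T coord_addZevec_neq // coord_addZevec_id; ring.
have Tj : T x j 0 = x j 0 / s.
  by rewrite /T coord_addZevec_id coord_addZevec_neq //; ring.
have TB : B (T x) <-> B x.
  by rewrite /T; split=> [/(invariantE _ _ jB)/(invariantE _ _ iB)//|Bx]; apply: jB; exact: iB.
have e1 : (0 <= s * x i 0) = (0 <= x i 0) by rewrite pmulr_rge0.
have e2 : (s * x i 0 <= L) = (x i 0 <= L / s) by rewrite ler_pdivlMr // mulrC.
have e3 : (0 <= x j 0 / s) = (0 <= x j 0) by rewrite pmulr_lge0 // invr_gt0.
have e4 : (x j 0 / s <= M) = (x j 0 <= M * s) by rewrite ler_pdivrMr.
apply: restr_eq => [|_].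
  by rewrite /= /rect /= Ti Tj e1 e2 e3 e4; split=> -[/TB].
rewrite /= !aff_slope Ti Tj /T affq_j affq_i; congr EFin.
by rewrite [a * (s * _)]mulrA; ring.
Qed.

Lemma rect_val_halves a b : f a b 1 1 = tri_val i j B q a b + tri_val j i B q b a.
Proof.
have [y [By yi yj]] := point 0 0.
pose g : 'cV[R]_n * R := (evec i - evec j, 0).
have g0 : g.1 != 0 := tri_neq0 ij.
rewrite /rect_val (cut_eq zP (Conv_sc_rect _ ler01 ler01) g0); last first.
  exists y; rewrite /aff /= dotvBl !dotv_evecl yi yj subrr addr0; split=> //.
  by apply/restr_proper; split=> //; split=> //; rewrite /rect /= yi yj.
by rewrite triNE triE !restr_restr !(setICA _ B) /tri_val (rectC j i) (slopeC j i).
Qed.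

(** A horizontal shear turns the square into a parallelogram consisting of the
    half [tri j i] and of a translate of the half [tri i j]. *)
Lemma rect_val_shear a b :
  f a (a + b) 1 1 = tri_val j i B q b a + expR a * tri_val i j B q a b.
Proof.
have [y [By yi yj]] := point 0 0.
pose p : 'cV[R]_n * R := (evec i, -1); have p0 : p.1 != 0 := evec_neq0 i.
have pE x : aff p x = x i 0 - 1 by rewrite aff_evec.
have oi : dotv (- evec j : 'cV[R]_n) (evec i) = 0.
  by rewrite dotvNl dotv_evec evecE (negbTE ij) oppr0.
have c1 := Conv_sc_rect (slope i j q a (a + b)) (@ler01 R) (@ler01 R).
have c2 := Conv_sc_shear oi c1.
rewrite /tri_val (rectC j i) (slopeC j i).
  rewrite /rect_val -(nf_shear zP oi c1) (cut_eq zP c2 p0); last first.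
    have [x [Bx xi xj]] := point 1 0; exists x; rewrite pE xi subrr; split=> //.
    apply/restr_proper; rewrite dotvNl dotv_evecl xj oppr0 scale0r addr0; split=> //.
    by split=> //; rewrite /rect /= xi xj.
  rewrite restr_comp !restr_restr.
  have Ti x : (x + dotv (- evec j) x *: evec i) i 0 = x i 0 - x j 0.
    by rewrite coord_addZevec_id dotvNl dotv_evecl.
  have Tj x : (x + dotv (- evec j) x *: evec i) j 0 = x j 0.
    by rewrite coord_addZevec_neq.
  have TB x : B (x + dotv (- evec j) x *: evec i) <-> B x by exact: invariantE.
  congr (_ + _).
    congr z; apply/funext => x; apply: restr_eq => [|_].
      rewrite /= /half /= pE /tri /rect /= Ti Tj.
      split=> [[xi [/TB Bx [h1 h2 h3 h4]]]|[Bx [h0 [h1 h2 h3 h4]]]].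
        by split=> //; split; [lra | split; lra].
      by split; [lra | split; [exact/TB | split; lra]].
    by rewrite /= !aff_slope Ti Tj affq_i; congr EFin; ring.
  rewrite -(nf_shift_addr zP (- 1 *: evec i) a); last first.
    apply: (@Conv_sc_sub_rect _ _ 1 1) => //.
    - by apply: closedI; [rewrite -triE; exact: closed_half | exact: closed_rect].
    - by apply: convex_setI; [rewrite -triE; exact: convex_half | exact: convex_rect].
    - exists y; split=> //; split; first by rewrite /tri /= yi yj.
      by rewrite /rect /= yi yj.
  congr z; apply/funext => x.
  have xi : (x + -1 *: evec i) i 0 = x i 0 - 1 by rewrite coord_addZevec_id.
  have xj : (x + -1 *: evec i) j 0 = x j 0 by rewrite coord_addZevec_neq.
  have Bx : B (x + -1 *: evec i) <-> B x by exact: invariantE.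
  set D := _ `&` _; have [Dx|Dx] := pselect (D x).
    rewrite restr_in // restr_in.
      by rewrite -EFinD /= !aff_slope Ti Tj xi xj !affq_i; congr EFin; ring.
    move: Dx => [+ [/= /TB Bx']]; rewrite /half /= affN pE /rect /= Ti Tj => h0 [h1 h2 h3 h4].
    split; first exact/Bx.
    by split; [rewrite /tri /= xi xj; lra | split; rewrite ?xi ?xj; lra].
  rewrite restr_out // restr_out // => -[/Bx Bx' []].
  rewrite /tri /rect /= xi xj => h0 [h1 h2 h3 h4]; apply: Dx.
  rewrite /D /half /= affN pE; split; first by lra.
  by split; [exact/TB | rewrite /rect /= Ti Tj; split; lra].
Qed.

Lemma rect_val_flat a b M : 0 <= M -> f a b 0 M = 0.
Proof.
move=> M0; apply: (vanish_flat zP (g := (evec i, 0))); first exact: evec_neq0.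
  move=> x /restr_proper[[_ [x0 x1 _ _]] _]; rewrite aff_evec addr0.
  by apply/eqP; rewrite eq_le x1 x0.
exact: Conv_sc_rect.
Qed.

(** When the slope along [evec i] tends to infinity, only the face of the
    rectangle where this coordinate is zero survives. *)
Lemma rect_val_decay b : f m.+1%:R b 1 1 @[m --> \oo] --> 0.
Proof.
have c0 := Conv_sc_rect (slope i j q 0 b) (@ler01 R) (@ler01 R).
have pE (x : 'cV[R]_n) : aff (evec i, 0) x = x i 0 by rewrite aff_evec addr0.
have ep : epi_converges (fun m x => u_ (rect i j 1 1) m.+1%:R b x)
    (u_ (rect i j 0 1) 0 b).
  have -> : u_ (rect i j 0 1) 0 b =
      restr [set x | aff (evec i, 0) x = 0] (u_ (rect i j 1 1) 0 b).
    rewrite restr_restr; apply/funext => x; apply: restr_eq => //.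
    rewrite /rect /= pE; split=> [[Bx [h1 h2 h3 h4]]|[h0 [Bx [h1 h2 h3 h4]]]].
      by repeat split=> //; lra.
    by split=> //; split=> //; lra.
  have -> : (fun m x => u_ (rect i j 1 1) m.+1%:R b x) =
    (fun m x => u_ (rect i j 1 1) 0%R b x + (aff (m.+1%:R *: (evec i, 0)) x)%:E)%E.
    apply/funext => m; apply/funext => x.
    have [Dx|Dx] := pselect ((B `&` rect i j 1 1) x); last by rewrite !restr_out.
    by rewrite !restr_in // -EFinD affZ pE !aff_slope; congr EFin; ring.
  apply: (epi_converges_penalty c0) => x /restr_proper[[_ [x0 _ _ _]] _].
  by rewrite pE.
have := nf_cvg zP _ (Conv_sc_rect _ (lexx 0) ler01) ep.
rewrite -/(rect_val i j B q 0 b 0 1) rect_val_flat //; apply => m.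
exact: Conv_sc_rect.
Qed.

(** After the quarter turn the rectangle has to be moved back by its side [L],
    along which the slope is [- a]. *)
Lemma rect_val_rotate a b L M : 0 <= L -> 0 <= M ->
  f a b L M = expR (a * L) * f b (- a) M L.
Proof.
move=> L0 M0; rewrite /rect_val -(nf_rotate ij (Conv_sc_rect _ L0 M0)).
rewrite -(nf_shift_addr zP (L *: evec j) (a * L) (Conv_sc_rect _ M0 L0)).
congr z; rewrite restr_comp; apply/funext => x.
set T := fun _ => _.
have Ti : T x i 0 = - x j 0.
  by rewrite /T coord_addZevec_neq // coord_addZevec_id; ring.
have Tj : T x j 0 = x i 0.
  by rewrite /T coord_addZevec_id coord_addZevec_neq //; ring.
have TB : B (T x) <-> B x.
  by rewrite /T; split=> [/(invariantE _ _ jB)/(invariantE _ _ iB)//|Bx]; apply: jB; exact: iB.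
have xi : (x + L *: evec j) i 0 = x i 0 by rewrite coord_addZevec_neq.
have xj : (x + L *: evec j) j 0 = x j 0 + L by rewrite coord_addZevec_id.
have Bx : B (x + L *: evec j) <-> B x by exact: invariantE.
have [Dx|Dx] := pselect ((T @^-1` (B `&` rect i j L M)) x).
  rewrite restr_in // restr_in.
    by rewrite -EFinD /= !aff_slope Ti Tj xi xj /T affq_j !affq_i affq_j; congr EFin; ring.
  move: Dx => -[/= /TB Bx']; rewrite /rect /= Ti Tj => -[h1 h2 h3 h4].
  by split; [exact/Bx | split; rewrite ?xi ?xj; lra].
rewrite restr_out // restr_out // => -[/Bx Bx' [+ + + +]].
rewrite xi xj => h1 h2 h3 h4; apply: Dx.
by split; [exact/TB | rewrite /rect /= Ti Tj; split; lra].
Qed.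

End Cylinder.
Section PositiveSlopes.
Context (z : ('cV[R]_n -> \bar R) -> R) (zP : null_functional z).
Context (i j : 'I_n) (ij : i != j) (B : set 'cV[R]_n) (cB : cylinder i j B).
Context (q : 'cV[R]_n * R) (qi : q.1 i 0 = 0) (qj : q.1 j 0 = 0).
Local Notation f := (rect_val z i j B q).

Let ji : j != i. Proof. by rewrite eq_sym. Qed.
Let cB' := cylinderC cB.

Let ex1 (a : R) : 0 < a -> expR a - 1 != 0.
Proof. by move=> a0; rewrite subr_eq0 gt_eqF // expR_gt1. Qed.

(** The density that remains after dividing out the exponential growth in both
    directions; it turns out to depend on the product of the slopes only. *)
Let K (a b : R) := f a b 1 1 / ((expR a - 1) * (expR b - 1)).

Let fK a b L M : 0 < a -> 0 < b -> 0 <= L -> 0 <= M ->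
  f a b L M = K a b * (expR (a * L) - 1) * (expR (b * M) - 1).
Proof.
move=> a0 b0 L0 M0.
have h1 := rect_val_ratio zP ij cB qi a b L0 (@ler01 R) M0.
have h2 := rect_val_ratio zP ji cB' qj b a M0 (@ler01 R) (@ler01 R).
rewrite -!(rect_valC z i j) !mulr1 in h1 h2.
have an := ex1 a0; have bn := ex1 b0.
rewrite /K; apply: (mulIf an); apply: (mulIf bn); rewrite h1 mulrAC h2; field.
by rewrite an bn.
Qed.

Let K_squeeze a b s : 0 < a -> 0 < b -> 0 < s -> K a b = K (a * s) (b / s).
Proof.
move=> a0 b0 s0; rewrite {1}/K (rect_val_squeeze zP ij cB qi qj a b s0) //.
have as0 : 0 < a * s by exact: mulr_gt0.
have bs0 : 0 < b / s by exact: divr_gt0.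
rewrite fK ?mul1r ?invr_ge0 ?ltW //.
have sn : s != 0 by rewrite gt_eqF.
have -> : a * s / s = a by rewrite mulfK.
have -> : b / s * s = b by rewrite divfK.
by rewrite -(mulrA (K _ _)) mulfK // mulf_neq0 // ex1.
Qed.

Let K_prod a b : 0 < a -> 0 < b -> K a b = K 1 (a * b).
Proof.
move=> a0 b0; rewrite (K_squeeze a0 b0 (s := a^-1)) ?invr_gt0 //.
by rewrite mulfV ?gt_eqF // invrK mulrC.
Qed.

(** The parallelograms obtained from the two halves of the square by the two
    shears have slopes [a] and [a + a]; eliminating the values of the halves
    leaves a relation between the values of rectangles. *)
Let K_diag a : 0 < a -> K a a = K a (a + a) + K (a + a) a.
Proof.
move=> a0; have aa0 : 0 < a + a by rewrite addr_gt0.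
have h := rect_val_halves zP ij cB q a a.
have t1 := rect_val_shear zP ij cB qi a a.
have t2 := rect_val_shear zP ji cB' qj a a.
rewrite -rect_valC in t2.
have an := ex1 a0; have aan := ex1 aa0.
have k0 : K a a * ((expR a - 1) * (expR a - 1)) = f a a 1 1.
  by rewrite /K divfK // mulf_neq0.
have k1 : K a (a + a) * ((expR a - 1) * (expR (a + a) - 1)) = f a (a + a) 1 1.
  by rewrite /K divfK // mulf_neq0.
have k2 : K (a + a) a * ((expR (a + a) - 1) * (expR a - 1)) = f (a + a) a 1 1.
  by rewrite /K divfK // mulf_neq0.
have E0 : expR a + 1 != 0 by rewrite gt_eqF // addr_gt0 // expR_gt0.
rewrite expRD in k1 k2.
apply: (mulIf E0); apply: (mulIf an); apply: (mulIf an).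
set T1 := tri_val _ _ _ _ _ _ _ in h t1 t2; set T2 := tri_val _ _ _ _ _ _ _ in h t1 t2.
have -> : (K a (a + a) + K (a + a) a) * (expR a + 1) * (expR a - 1) * (expR a - 1) =
  f a (a + a) 1 1 + f (a + a) a 1 1 by rewrite -k1 -k2; ring.
rewrite t1 t2; have -> : K a a * (expR a + 1) * (expR a - 1) * (expR a - 1) =
  (expR a + 1) * f a a 1 1 by rewrite -k0; ring.
by rewrite h; ring.
Qed.

Let K1_double c : 0 < c -> K 1 c = 2 * K 1 (2 * c).
Proof.
move=> c0; pose a := Num.sqrt c; have a0 : 0 < a by rewrite sqrtr_gt0.
have aa : a * a = c by rewrite -expr2 sqr_sqrtr // ltW.
have aa0 : 0 < a + a by rewrite addr_gt0.
have e1 : a * (a + a) = 2 * c by rewrite -aa; ring.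
have e2 : (a + a) * a = 2 * c by rewrite -aa; ring.
have := K_diag a0; rewrite (K_prod a0 a0) (K_prod a0 aa0) (K_prod aa0 a0) aa e1 e2.
by move=> ->; ring.
Qed.

Let K1_pow c m : 0 < c -> K 1 (2 ^+ m * c) = K 1 c / 2 ^+ m.
Proof.
move=> c0; elim: m => [|m IH]; first by rewrite !expr0 mul1r divr1.
have := K1_double (_ : 0 < 2 ^+ m * c); rewrite IH mulrA -exprS => /(_ _) h.
have p0 : (2 ^+ m : R) != 0 by rewrite expf_neq0.
rewrite exprS invfM mulrCA -exprS.
by rewrite h ?mulr_gt0 ?exprn_gt0 //; field.
Qed.

(** Doubling the product of the slopes only halves the density, which is not
    compatible with the exponential decay imposed by continuity. *)
Let K1_eq0 c : 0 < c -> K 1 c = 0.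
Proof.
move=> c0; apply/eqP; apply: contraT => kn0.
have dec := rect_val_decay zP ij cB q c.
pose e := `|K 1 c * (expR c - 1)|.
have e0 : 0 < e by rewrite normr_gt0 mulf_neq0 // ex1.
have /cvgrPdist_lt /(_ e e0)[N _ HN] := dec.
have P0 : 0 < 2 ^+ N :> R by rewrite exprn_gt0.
(* At the slope [2 ^+ N] the value is [K 1 c * (expR c - 1)] times a factor that
   is at least one. *)
have : `|f (2 ^+ N) c 1 1| < e.
  have N2 : (N < 2 ^ N)%N by exact: ltn_expl.
  have := HN (2 ^ N).-1; rewrite /= prednK ?expn_gt0 // sub0r normrN natrX; apply.
  by rewrite -ltnS prednK ?expn_gt0.
rewrite fK // !mulr1 K_prod // K1_pow //.
have -> : K 1 c / 2 ^+ N * (expR (2 ^+ N) - 1) * (expR c - 1) =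
  (K 1 c * (expR c - 1)) * ((expR (2 ^+ N) - 1) / 2 ^+ N) by ring.
rewrite normrM -/e gtr_pMr // ltNge => /negP; case.
have E1 : 1 <= expR (2 ^+ N : R) by rewrite ltW // expR_gt1.
rewrite ger0_norm; last by rewrite divr_ge0 ?subr_ge0 // ltW.
by rewrite ler_pdivlMr // mul1r; have := expR_ge1Dx (2 ^+ N : R); lra.
Qed.

Lemma rect_val_pos a b L M : 0 < a -> 0 < b -> 0 <= L -> 0 <= M -> f a b L M = 0.
Proof.
by move=> a0 b0 L0 M0; rewrite fK // K_prod // K1_eq0 ?mulr_gt0 // !mul0r.
Qed.

End PositiveSlopes.

Section ArbitrarySlopes.
Context (z : ('cV[R]_n -> \bar R) -> R) (zP : null_functional z).

(** This reduces degenerate slopes to generic ones. *)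
Lemma vanish_perturb D p g : (forall x, D x -> 0 <= aff g x) ->
  (forall m, vanish z (restr D (fun x => (aff (p + m.+1%:R^-1 *: g) x)%:E))) ->
  vanish z (restr D (fun x => (aff p x)%:E)).
Proof.
move=> Dg vp.
have e m : restr D (fun x => (aff (p + m.+1%:R^-1 *: g) x)%:E) =
    (fun x => restr D (fun x => (aff p x)%:E) x + (aff (m.+1%:R^-1 *: g) x)%:E)%E.
  apply/funext => x; have [Dx|Dx] := pselect (D x); last by rewrite !restr_out.
  by rewrite !restr_in // affD.
apply: (vanish_limit zP _ vp) => [m cu|cu].
  by rewrite e; exact: Conv_sc_add_aff.
under eq_fun do rewrite e.
by apply: epi_converges_perturb => // x /restr_proper[/Dg].
Qed.

(** Quarter turns carry positive slopes to all other combinations of signs, and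
    slopes equal to zero are limits of positive ones. *)
Lemma rect_val_eq0 i j B q a b L M : i != j -> cylinder i j B ->
  q.1 i 0 = 0 -> q.1 j 0 = 0 -> 0 <= L -> 0 <= M -> rect_val z i j B q a b L M = 0.
Proof.
move=> ij cB qi qj L0 M0; have ji : j != i by rewrite eq_sym.
have rot a' b' L' M' : 0 <= L' -> 0 <= M' -> rect_val z i j B q b' (- a') M' L' = 0 ->
    rect_val z i j B q a' b' L' M' = 0.
  by move=> L'0 M'0 h; rewrite rect_val_rotate // h mulr0.
have pp a' b' L' M' : 0 < a' -> 0 < b' -> 0 <= L' -> 0 <= M' ->
    rect_val z i j B q a' b' L' M' = 0 by exact: rect_val_pos.
have np a' b' L' M' : a' < 0 -> 0 < b' -> 0 <= L' -> 0 <= M' ->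
    rect_val z i j B q a' b' L' M' = 0.
  by move=> *; apply: rot => //; apply: pp => //; rewrite oppr_gt0.
have nn a' b' L' M' : a' < 0 -> b' < 0 -> 0 <= L' -> 0 <= M' ->
    rect_val z i j B q a' b' L' M' = 0.
  by move=> *; apply: rot => //; apply: np => //; rewrite oppr_gt0.
have pn a' b' L' M' : 0 < a' -> b' < 0 -> 0 <= L' -> 0 <= M' ->
    rect_val z i j B q a' b' L' M' = 0.
  by move=> *; apply: rot => //; apply: nn => //; rewrite oppr_lt0.
have neq0 a' b' : a' != 0 -> b' != 0 -> rect_val z i j B q a' b' L M = 0.
  move=> a'0 b'0; case: (ltrgtP a' 0) a'0 => // ha _; case: (ltrgtP b' 0) b'0 => // hb _.
  - exact: nn.
  - exact: np.
  - exact: pn.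
  - exact: pp.
have slopeD a' b' (c : R) : slope i j q a' b' + c *: (evec i, 0) = slope i j q (a' + c) b'.
  rewrite /slope; congr pair; last by rewrite /= scaler0 addr0.
  by rewrite /= scalerDl -!addrA; congr (_ + (_ + _)); exact: addrC.
have slopeD' a' b' (c : R) : slope i j q a' b' + c *: (evec j, 0) = slope i j q a' (b' + c).
  rewrite /slope; congr pair; last by rewrite /= scaler0 addr0.
  by rewrite /= scalerDl -!addrA.
have bneq0 b' : b' != 0 -> rect_val z i j B q a b' L M = 0.
  move=> b'0; have [->|an0] := eqVneq a 0; last exact: neq0.
  apply: (vanish_perturb (g := (evec i, 0))) => [x [_ [x0 _ _ _]]|m|].
  - by rewrite aff_evec addr0.
  - by rewrite slopeD add0r => _; apply: neq0 => //; rewrite invr_eq0 pnatr_eq0.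
  - exact: Conv_sc_rect.
have [->|bn0] := eqVneq b 0; last exact: bneq0.
apply: (vanish_perturb (g := (evec j, 0))) => [x [_ [_ _ x0 _]]|m|].
- by rewrite aff_evec addr0.
- by rewrite slopeD' add0r => _; apply: bneq0 => //; rewrite invr_eq0 pnatr_eq0.
- exact: Conv_sc_rect.
Qed.

Lemma rect_vanish i j B p L M : i != j -> closed B -> convex_set B ->
  invariant i B -> invariant j B -> 0 <= L -> 0 <= M ->
  vanish z (restr (B `&` rect i j L M) (fun x => (aff p x)%:E)).
Proof.
move=> ij clB vB iB jB L0 M0 cu; have ji : j != i by rewrite eq_sym.
pose a := p.1 i 0; pose b := p.1 j 0.
pose q : 'cV[R]_n * R := (p.1 + (- a) *: evec i + (- b) *: evec j, p.2).
have pE : p = slope i j q a b.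
  rewrite /slope /q /= [p]surjective_pairing /=; congr pair.
  by apply/matrixP => k l; rewrite !mxE; ring.
have [N HN] := Conv_sc_aff_bounded cu; have [x [Bx Rx]] := Conv_sc_aff_nonempty cu.
have cB : cylinder i j B.
  split=> //.
    exists (x + (- x i 0) *: evec i + (- x j 0) *: evec j); split.
    - by apply: jB; exact: iB.
    - by rewrite coord_addZevec_neq // coord_addZevec_id subrr.
    - by rewrite coord_addZevec_id coord_addZevec_neq // subrr.
  exists N => y By yi yj; apply: HN; split=> //.
  by rewrite /rect /= yi yj.
rewrite pE; apply: rect_val_eq0 => //; rewrite /q /=.
  by rewrite coord_addZevec_neq // coord_addZevec_id subrr.
by rewrite coord_addZevec_id coord_addZevec_neq // subrr.
Qed.

End ArbitrarySlopes.
End Rectangles.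
(** * From rectangles to polyhedra *)

Section Polyhedra.
Context {R : realType} {n : nat}.
Implicit Types (x y : 'cV[R]_n) (p g c : 'cV[R]_n * R) (B D : set 'cV[R]_n) (i j : 'I_n).
Context (z : ('cV[R]_n -> \bar R) -> R) (zP : null_functional z).

Definition slab j (h : R) : set 'cV[R]_n := [set x | 0 <= x j 0 <= h].

Lemma slabE j h : slab j h = [set x | 0 <= x j 0] `&` [set x | x j 0 <= h].
Proof. by apply/seteqP; split=> x => [/andP[]|[? ?]] //; apply/andP. Qed.

Lemma closed_slab j h : closed (slab j h).
Proof. by rewrite slabE; apply: closedI; [exact: closed_coord_ge | exact: closed_coord_le]. Qed.

Lemma convex_slab j h : convex_set (slab j h).
Proof. by rewrite slabE; apply: convex_setI; [exact: convex_coord_ge | exact: convex_coord_le]. Qed.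

(** The part of a cylinder below a graph and the part above it can be
    reassembled into a sheared cylinder after lifting the lower part by the
    height [h]. Both cylinders have value zero, and the lift multiplies the
    value of the lower part by a factor other than one. *)
Lemma truncated_cylinder_vanish0 j B g p : closed B -> convex_set B ->
  invariant j B -> g.1 j 0 = 0 -> (forall x, B x -> 0 <= aff g x) -> p.1 j 0 != 0 ->
  (forall h p', 0 <= h -> vanish z (restr (B `&` slab j h) (fun x => (aff p' x)%:E))) ->
  vanish z (restr (B `&` [set x : 'cV[R]_n | 0 <= x j 0 <= aff g x])
                  (fun x => (aff p x)%:E)).
Proof.
move=> clB vB jB gj Bg pj vcyl cP; set P := _ `&` _ in cP *.
have ge : dotv g.1 (evec j) = 0 by rewrite dotv_evec.
have affg x (t : R) : aff g (x + t *: evec j) = aff g x.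
  by rewrite aff_addr dotvZr ge mulr0 addr0.
have [N HN] := Conv_sc_aff_bounded cP; have [x0 [Bx0 Px0]] := Conv_sc_aff_nonempty cP.
have lift x (t : R) : B x -> [/\ B (x + (t - x j 0) *: evec j),
    (x + (t - x j 0) *: evec j) j 0 = t &
    aff g (x + (t - x j 0) *: evec j) = aff g x].
  by move=> Bx; rewrite affg coord_addZevec_id subrKC; split=> //; exact: jB.
have gN x : B x -> aff g x <= N.
  move=> Bx; have [By yj gy] := lift x (aff g x) Bx.
  rewrite -[leLHS]yj (le_trans (ler_norm _)) // (le_trans (coord_le_norm _ _)) //.
  by apply: HN; split=> //=; rewrite yj gy lexx andbT Bg.
(* The height is chosen above the graph of [g]. *)
pose h := `|N| + 1; have h0 : 0 < h by rewrite ltr_wpDl.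
have gh x : B x -> aff g x <= h.
  by move=> /gN gx; rewrite (le_trans gx) // /h (le_trans (ler_norm N)) // lerDl.
pose C := B `&` slab j h.
have cC p' : Conv_sc (restr C (fun x => (aff p' x)%:E)).
  apply: (@Conv_sc_aff _ _ _ _ (N + h)).
  - by apply: closedI => //; exact: closed_slab.
  - by apply: convex_setI => //; exact: convex_slab.
  - have [By yj _] := lift x0 0 Bx0; eexists; split; first exact: By.
    by rewrite /slab /= yj lexx ltW.
  move=> x [Bx /andP[xj0 xjh]]; have [By yj gy] := lift x 0 Bx.
  rewrite /cube /= -[x](subrK ((0 - x j 0) *: evec j)) addrAC.
  rewrite (le_trans (ler_normB _ _)) // lerD //.
    by apply: HN; split=> //=; rewrite yj gy lexx Bg.
  rewrite normrZ sub0r normrN ger0_norm // -[leRHS]mulr1 ler_pM //.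
  exact: norm_evec_le.
pose e : 'cV[R]_n * R := (evec j, - h).
pose k : 'cV[R]_n * R := (evec j, 0) - g.
have kE x : aff k x = x j 0 - aff g x by rewrite affB aff_evec addr0.
have k0 : k.1 != 0.
  apply/eqP => /matrixP/(_ j 0); rewrite !mxE eqxx gj subr0 /= => /eqP.
  by rewrite oner_eq0.
have eE x : aff e x = x j 0 - h by rewrite aff_evec.
have e0 : e.1 != 0 := evec_neq0 j.
pose U := B `&` [set x : 'cV[R]_n | aff g x <= x j 0 <= h].
have below_above : z (restr P (fun x => (aff p x)%:E)) + z (restr U (fun x => (aff p x)%:E)) = 0.
  rewrite -(vcyl h p (ltW h0) (cC p)) (cut_eq zP (cC p) k0); last first.
    have [By yj gy] := lift x0 (aff g x0) Bx0.
    exists (x0 + (aff g x0 - x0 j 0) *: evec j); split; last by rewrite kE yj gy subrr.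
    apply/restr_proper; split=> //; split=> //=.
    by apply/andP; rewrite yj; split; [exact: Bg | exact: gh].
  rewrite !restr_restr; congr (z _ + z _); apply/funext => x; apply: restr_eq => //.
    rewrite /P /C /half /slab /= kE; split=> [[Bx /andP[h1 h2]]|[h1 [Bx /andP[h2 h3]]]].
      by have := gh x Bx; split; [lra | split=> //; apply/andP; split; lra].
    by split=> //; apply/andP; split; lra.
  rewrite /U /C /half /slab /= affN kE; split=> [[Bx /andP[h1 h2]]|[h1 [Bx /andP[h2 h3]]]].
    by have := Bg x Bx; split; [lra | split=> //; apply/andP; split; lra].
  by split=> //; apply/andP; split; lra.
pose p' := p + p.1 j 0 *: g; pose T x := x + aff (- g) x *: evec j.
have nge : dotv (- g).1 (evec j) = 0 by rewrite /= dotvNl ge oppr0.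
have Tj x : T x j 0 = x j 0 - aff g x by rewrite /T coord_addZevec_id affN.
have TB x : B (T x) <-> B x by exact: invariantE.
have Tp x : aff p' (T x) = aff p x.
  rewrite /p' affD affZ /T affg aff_addr dotvZr dotv_evec affN; ring.
have cW := Conv_sc_affine_shear nge (cC p').
have above_lifted : z (restr U (fun x => (aff p x)%:E)) +
    expR (p.1 j 0 * h) * z (restr P (fun x => (aff p x)%:E)) = 0.
  rewrite -(vcyl h p' (ltW h0) (cC p')) -(nf_affine_shear zP nge (cC p')).
  rewrite (cut_eq zP cW e0); last first.
    have [By yj gy] := lift x0 h Bx0.
    exists (x0 + (h - x0 j 0) *: evec j); split; last by rewrite eE yj subrr.
    apply/restr_proper; split=> //; split; first exact/TB.
    by rewrite /slab /= -/(T _) Tj yj gy; have := gh _ Bx0; have := Bg _ Bx0; lra.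
  rewrite restr_comp !restr_restr -/T; congr (_ + _).
    congr z; apply/funext => x; apply: restr_eq => [|_]; last by rewrite /= Tp.
    rewrite /U /half /C /slab /= eE Tj; split=> [[Bx /andP[h1 h2]]|[h1 [/TB Bx /andP[h2 h3]]]].
      have := Bg x Bx; split; first by lra.
      by split; [exact/TB | apply/andP; split; lra].
    by split=> //; apply/andP; split; lra.
  rewrite -(nf_shift_addr zP (- h *: evec j) (p.1 j 0 * h) cP); congr z; apply/funext => x.
  have xj : (x + - h *: evec j) j 0 = x j 0 - h by rewrite coord_addZevec_id.
  have Bx : B (x + - h *: evec j) <-> B x by exact: invariantE.
  set D := (X in _ = restr X _ _); have [Dx|Dx] := pselect (D x).
    rewrite [RHS]restr_in // restr_in.
      by rewrite -EFinD /= Tp aff_addr dotvZr dotv_evec; congr EFin; ring.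
    move: Dx; rewrite /D /half /C /slab /= affN eE Tj => -[h1 [/TB Bx' /andP[h2 h3]]].
    by split; [exact/Bx | rewrite /= xj affg; apply/andP; split; lra].
  rewrite [RHS]restr_out // restr_out // /P /= xj affg => -[/Bx Bx' /andP[h1 h2]]; apply: Dx.
  rewrite /D /half /C /slab /= affN eE Tj; have := gh x Bx'; split; first by lra.
  by split; [exact/TB | apply/andP; split; lra].
have a0 : expR (p.1 j 0 * h) - 1 != 0.
  by rewrite subr_eq0 -expR0 (inj_eq (@expR_inj R)) mulf_neq0 // gt_eqF.
apply: (mulfI a0); rewrite mulr0; move: below_above above_lifted.
by set v := z _; set w := z _; lra.
Qed.

Lemma truncated_cylinder_vanish j B g p : closed B -> convex_set B ->
  invariant j B -> g.1 j 0 = 0 -> (forall x, B x -> 0 <= aff g x) ->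
  (forall h p', 0 <= h -> vanish z (restr (B `&` slab j h) (fun x => (aff p' x)%:E))) ->
  vanish z (restr (B `&` [set x : 'cV[R]_n | 0 <= x j 0 <= aff g x])
                  (fun x => (aff p x)%:E)).
Proof.
move=> clB vB jB gj Bg vcyl; have [pj|pj] := eqVneq (p.1 j 0) 0; last first.
  exact: truncated_cylinder_vanish0.
apply: (vanish_perturb zP (g := (evec j, 0))) => [x [_ /andP[x0 _]]|m].
  by rewrite aff_evec addr0.
apply: truncated_cylinder_vanish0 => //.
by rewrite !mxE pj !eqxx mulr1 add0r invr_eq0 pnatr_eq0.
Qed.

(** ** Fourier-Motzkin elimination *)

Implicit Types (C E Lo Up : seq ('cV[R]_n * R)).

Definition poly C : set 'cV[R]_n := [set x | forall c, c \in C -> aff c x <= 0].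

Lemma poly_cons c C : poly (c :: C) = half c `&` poly C.
Proof.
apply/seteqP; split=> [x h|x [hc hC] d]; last by rewrite inE => /orP[/eqP ->|/hC].
by split=> [|d dC]; apply: h; rewrite inE ?eqxx ?dC ?orbT.
Qed.

Lemma poly_nil : poly [::] = setT.
Proof. by apply/seteqP; split. Qed.

Lemma closed_poly C : closed (poly C).
Proof.
elim: C => [|c C IH]; first by rewrite poly_nil; exact: closedT.
by rewrite poly_cons; apply: closedI => //; exact: closed_half.
Qed.

Lemma convex_poly C : convex_set (poly C).
Proof.
elim: C => [|c C IH]; first by rewrite poly_nil.
by rewrite poly_cons; apply: convex_setI => //; exact: convex_half.
Qed.

Lemma invariant_poly j C : (forall c, c \in C -> c.1 j 0 = 0) -> invariant j (poly C).
Proof.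
by move=> Cj x t Cx c cC; rewrite aff_addr dotvZr dotv_evec Cj // mulr0 addr0 Cx.
Qed.

Lemma invariantI j B D : invariant j B -> invariant j D -> invariant j (B `&` D).
Proof. by move=> iB iD x t [/iB Bx /iD Dx]. Qed.

(** Constraints that involve the coordinate [j] are kept solved for it, because
    the elimination compares them with each other. *)
Definition region j (B : set 'cV[R]_n) C Lo Up : set 'cV[R]_n :=
  [set x | [/\ B x, poly C x, forall l, l \in Lo -> aff l x <= x j 0 &
               forall u, u \in Up -> x j 0 <= aff u x]].

Lemma region_eq_mem j B C Lo Lo' Up Up' : Lo =i Lo' -> Up =i Up' ->
  region j B C Lo Up = region j B C Lo' Up'.
Proof.
move=> eLo eUp; apply/seteqP; split=> x [Bx Cx lx ux]; split=> // d.
- by rewrite -eLo => /lx.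
- by rewrite -eUp => /ux.
- by rewrite eLo => /lx.
- by rewrite eUp => /ux.
Qed.

Lemma region_upper_drop j B C Lo Up u v :
  region j B (u - v :: C) Lo (u :: Up) = half (u - v) `&` region j B C Lo [:: u, v & Up].
Proof.
rewrite /region poly_cons; apply/seteqP; split=> x /=.
  move=> [Bx [hx Cx] lx ux]; split=> //; split=> // d.
  have uw := ux _ (mem_head _ _); rewrite /half /= affB in hx.
  rewrite !inE => /or3P[/eqP ->|/eqP ->|dU] //; first by lra.
  by apply: ux; rewrite inE dU orbT.
move=> [hx [Bx Cx lx ux]]; split=> // d.
by rewrite inE => /orP[/eqP ->|dU]; apply: ux; rewrite !inE ?eqxx ?dU ?orbT.
Qed.

Lemma region_lower_drop j B C Lo Up l v :
  region j B (v - l :: C) (l :: Lo) Up = half (v - l) `&` region j B C [:: l, v & Lo] Up.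
Proof.
rewrite /region poly_cons; apply/seteqP; split=> x /=.
  move=> [Bx [hx Cx] lx ux]; split=> //; split=> // d.
  have lw := lx _ (mem_head _ _); rewrite /half /= affB in hx.
  rewrite !inE => /or3P[/eqP ->|/eqP ->|dU] //; first by lra.
  by apply: lx; rewrite inE dU orbT.
move=> [hx [Bx Cx lx ux]]; split=> // d.
by rewrite inE => /orP[/eqP ->|dU]; apply: lx; rewrite !inE ?eqxx ?dU ?orbT.
Qed.

Section Elimination.
(** The linear space [S] restricts the slopes of the constraints: it keeps one
    coordinate out of them while another one is eliminated. *)
Context (j : 'I_n) (B : set 'cV[R]_n) (S : 'cV[R]_n -> Prop).
Context (clB : closed B) (vB : convex_set B) (jB : invariant j B).
Context (Sj : S (evec j)) (Slin : forall (t : R) x y, S x -> S y -> S (t *: x + y)).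

Let free c := S c.1 /\ c.1 j 0 = 0.

Context (vcyl : forall C h p, (forall c, c \in C -> free c) -> 0 <= h ->
  vanish z (restr ((B `&` poly C) `&` slab j h) (fun x => (aff p x)%:E))).

Let freeB c d : free c -> free d -> free (c - d).
Proof.
move=> [Sc cj] [Sd dj]; split; last by rewrite !mxE cj dj subrr.
by rewrite /= addrC -scaleN1r; exact: Slin.
Qed.

Let free_cons c C : free c -> (forall c, c \in C -> free c) ->
  forall d, d \in c :: C -> free d.
Proof. by move=> fc fC d; rewrite inE => /orP[/eqP ->|/fC]. Qed.

(** A shear moves the lower bound to zero, which leaves a truncated cylinder.
    The additional constraint [l <= u] does not change the region. *)
Lemma one_lower_one_upper C l u p : (forall c, c \in C -> free c) -> free l -> free u ->
  vanish z (restr (region j B C [:: l] [:: u]) (fun x => (aff p x)%:E)).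
Proof.
move=> fC fl fu; have flu := freeB fl fu; have ful := freeB fu fl.
pose C' := (l - u) :: C; have fC' := free_cons flu fC.
have nle : dotv (- l).1 (evec j) = 0 by rewrite /= dotvNl dotv_evec fl.2 oppr0.
have jC' : invariant j (B `&` poly C').
  by apply: invariantI => //; apply: invariant_poly => c /fC'[].
have vP := @truncated_cylinder_vanish j (B `&` poly C') (u - l) (p + p.1 j 0 *: l).
have {}vP := vP (closedI clB (@closed_poly C')) (convex_setI vB (@convex_poly C')) jC' ful.2.
have {}vP := vP _ (fun h p' h0 => vcyl (p := p') fC' h0).
have /vP {}vP : forall x, (B `&` poly C') x -> 0 <= aff (u - l) x.
  by move=> x [_ /(_ _ (mem_head _ _))]; rewrite !affB; lra.
have := vanish_affine_shear zP nle vP; rewrite restr_comp.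
congr (vanish z _); apply/funext => x.
have lxj (t : R) : aff l (x + t *: evec j) = aff l x.
  by rewrite aff_addr dotvZr dotv_evec fl.2 mulr0 addr0.
have uxj (t : R) : aff u (x + t *: evec j) = aff u x.
  by rewrite aff_addr dotvZr dotv_evec fu.2 mulr0 addr0.
apply: restr_eq => [|_]; last first.
  by rewrite /= affD affZ lxj aff_addr dotvZr dotv_evec affN; congr EFin; ring.
have inv := invariantE x (aff (- l) x) jC'.
split=> [[/inv[Bx]]|[Bx Cx /(_ _ (mem_head _ _)) lx /(_ _ (mem_head _ _)) ux]].
  rewrite /C' poly_cons /= coord_addZevec_id affB lxj uxj affN => -[lux Cx] /andP[h1 h2].
  by split=> // ? /[!inE] /eqP ->; lra.
split; first apply/inv.
  by split=> //; rewrite /C' poly_cons; split=> //; rewrite /half /= affB; lra.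
by rewrite /= coord_addZevec_id affB lxj uxj affN; apply/andP; split; lra.
Qed.

(** On either side of the hyperplane where two bounds agree one of them is
    redundant. *)
Lemma one_lower C l u Up p : (forall c, c \in C -> free c) -> free l ->
  (forall d, d \in u :: Up -> free d) ->
  vanish z (restr (region j B C [:: l] (u :: Up)) (fun x => (aff p x)%:E)).
Proof.
move=> + fl; elim: Up u C => [|v Up IH] u C fC fUp.
  by apply: one_lower_one_upper => //; apply: fUp; exact: mem_head.
have fu : free u by apply: fUp; exact: mem_head.
have fv : free v by apply: fUp; rewrite !inE eqxx orbT.
have fUp' d : d \in Up -> free d by move=> dU; apply: fUp; rewrite !inE dU !orbT.
apply: (cut_vanish zP (g := u - v)); rewrite restr_restr.
  rewrite -region_upper_drop; apply: IH; first exact: free_cons (freeB fu fv) fC.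
  exact: free_cons.
have uv : [:: u, v & Up] =i [:: v, u & Up] by move=> d; rewrite !inE orbCA.
rewrite opprB (@region_eq_mem j B C _ _ _ _ (fun=> erefl) uv) -region_upper_drop.
by apply: IH; [exact: free_cons (freeB fv fu) fC | exact: free_cons].
Qed.

Lemma lowers_uppers C l Lo u Up p : (forall c, c \in C -> free c) ->
  (forall d, d \in l :: Lo -> free d) -> (forall d, d \in u :: Up -> free d) ->
  vanish z (restr (region j B C (l :: Lo) (u :: Up)) (fun x => (aff p x)%:E)).
Proof.
move=> + + fUp; elim: Lo l C => [|v Lo IH] l C fC fLo.
  by apply: one_lower => //; apply: fLo; exact: mem_head.
have fl : free l by apply: fLo; exact: mem_head.
have fv : free v by apply: fLo; rewrite !inE eqxx orbT.
have fLo' d : d \in Lo -> free d by move=> dU; apply: fLo; rewrite !inE dU !orbT.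
apply: (cut_vanish zP (g := v - l)); rewrite restr_restr.
  rewrite -region_lower_drop; apply: IH; first exact: free_cons (freeB fv fl) fC.
  exact: free_cons.
have lv : [:: l, v & Lo] =i [:: v, l & Lo] by move=> d; rewrite !inE orbCA.
rewrite opprB (@region_eq_mem j B C _ _ _ _ lv (fun=> erefl)) -region_lower_drop.
by apply: IH; [exact: free_cons (freeB fl fv) fC | exact: free_cons].
Qed.

(** Solving a constraint for the coordinate [j] makes it a lower or an upper
    bound, according to the sign of its coefficient. *)
Lemma elimination C E l Lo u Up p : (forall c, c \in C -> free c) ->
  (forall c, c \in E -> S c.1) ->
  (forall d, d \in l :: Lo -> free d) -> (forall d, d \in u :: Up -> free d) ->
  vanish z (restr (region j B C (l :: Lo) (u :: Up) `&` poly E) (fun x => (aff p x)%:E)).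
Proof.
elim: E C l Lo u Up => [|c E IH] C l Lo u Up fC SE fLo fUp.
  by rewrite poly_nil setIT; exact: lowers_uppers.
have Sc : S c.1 by apply: SE; exact: mem_head.
have SE' d : d \in E -> S d.1 by move=> dE; apply: SE; rewrite inE dE orbT.
pose a := c.1 j 0; pose c0 : 'cV[R]_n * R := c - a *: (evec j, 0).
have cE x : aff c x = aff c0 x + a * x j 0.
  by rewrite /c0 affB affZ aff_evec addr0 subrK.
have S0 : S 0 by rewrite -(subrr (evec j)) addrC -scaleN1r; exact: Slin.
have fc0 (t : R) : free (t *: c0).
  split; last by rewrite /c0 !mxE eqxx mulr1 subrr mulr0.
  rewrite /= -[X in S X]addr0; apply: Slin => //.
  by rewrite -scaleNr addrC; exact: Slin.
have solve x : a != 0 -> aff (- a^-1 *: c0) x = x j 0 - aff c x / a.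
  by move=> an; rewrite cE affZ; field.
rewrite poly_cons setIA.
have [a0|a0|a0] := ltgtP a 0.
- have -> : region j B C (l :: Lo) (u :: Up) `&` half c =
      region j B C (- a^-1 *: c0 :: l :: Lo) (u :: Up).
    apply/seteqP; split=> x.
      move=> [[Bx Cx lx ux] cx]; split=> // d.
      rewrite inE => /orP[/eqP ->|/lx //].
      by rewrite solve ?lt_eqF // gerBl nmulr_lge0 ?invr_lt0.
    move=> [Bx Cx lx ux]; split.
      by split=> // d dL; apply: lx; rewrite inE dL orbT.
    have := lx _ (mem_head _ _).
    by rewrite solve ?lt_eqF // gerBl nmulr_lge0 ?invr_lt0.
  by apply: IH => //; exact: free_cons.
- have -> : region j B C (l :: Lo) (u :: Up) `&` half c =
      region j B C (l :: Lo) (- a^-1 *: c0 :: u :: Up).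
    apply/seteqP; split=> x.
      move=> [[Bx Cx lx ux] cx]; split=> // d.
      rewrite inE => /orP[/eqP ->|/ux //].
      by rewrite solve ?gt_eqF // lerBrDr gerDl pmulr_lle0 ?invr_gt0.
    move=> [Bx Cx lx ux]; split.
      by split=> // d dL; apply: ux; rewrite inE dL orbT.
    have := ux _ (mem_head _ _).
    by rewrite solve ?gt_eqF // lerBrDr gerDl pmulr_lle0 ?invr_gt0.
  by apply: IH => //; exact: free_cons.
have -> : region j B C (l :: Lo) (u :: Up) `&` half c =
    region j B (c :: C) (l :: Lo) (u :: Up).
  rewrite /region poly_cons; apply/seteqP; split=> x.
    by move=> [[Bx Cx lx ux] cx]; split.
  by move=> [Bx [cx Cx] lx ux]; split.
by apply: IH => //; exact: free_cons.
Qed.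

End Elimination.
Definition band j (N : R) : set 'cV[R]_n := [set x | - N <= x j 0 <= N].

Lemma bandE j N : band j N = [set x | - N <= x j 0] `&` [set x | x j 0 <= N].
Proof. by apply/seteqP; split=> x => [/andP[]|[? ?]] //; apply/andP. Qed.

Lemma closed_band j N : closed (band j N).
Proof. by rewrite bandE; apply: closedI; [exact: closed_coord_ge | exact: closed_coord_le]. Qed.

Lemma convex_band j N : convex_set (band j N).
Proof. by rewrite bandE; apply: convex_setI; [exact: convex_coord_ge | exact: convex_coord_le]. Qed.

Lemma invariant_slab i j h : i != j -> invariant j (slab i h).
Proof. by move=> ij x t; rewrite /slab /= coord_addZevec_neq. Qed.

Lemma invariant_band i j N : i != j -> invariant j (band i N).
Proof. by move=> ij x t; rewrite /band /= coord_addZevec_neq. Qed.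

Lemma region_band j B N : region j B [::] [:: (0, - N)] [:: (0, N)] = B `&` band j N.
Proof.
rewrite /region poly_nil; apply/seteqP; split=> x /=.
  move=> [Bx _ /(_ _ (mem_head _ _)) lx /(_ _ (mem_head _ _)) ux]; split=> //.
  by move: lx ux; rewrite /aff /= dotv0l !add0r /band /= => -> ->.
by move=> [Bx /andP[h1 h2]]; split=> // d; rewrite inE => /eqP ->; rewrite /aff /= dotv0l add0r.
Qed.

(** Elimination of the second coordinate, for constraints free of the first
    one: here the cylinders are products with rectangles. *)
Lemma slab_band_vanish i j C p h N : i != j -> 0 <= h ->
  (forall c, c \in C -> c.1 i 0 = 0) ->
  vanish z (restr ((band j N `&` poly C) `&` slab i h) (fun x => (aff p x)%:E)).
Proof.
move=> ij h0 Ci; have ji : j != i by rewrite eq_sym.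
have -> : (band j N `&` poly C) `&` slab i h =
    region j (slab i h) [::] [:: (0, - N)] [:: (0, N)] `&` poly C.
  by rewrite region_band setIC setIA.
apply: (@elimination j (slab i h) (fun a => a i 0 = 0)) => //.
- exact: closed_slab.
- exact: convex_slab.
- exact: invariant_slab.
- by rewrite evecE (negbTE ij).
- by move=> t x y xi yi; rewrite !mxE xi yi mulr0 addr0.
- move=> C' h' p' C'f h'0.
  have -> : (slab i h `&` poly C') `&` slab j h' = poly C' `&` rect i j h h'.
    by apply/seteqP; split=> x;
      [move=> [[/andP[? ?] ?] /andP[? ?]] | move=> [? [? ? ? ?]]]; repeat split=> //;
      apply/andP.
  apply: rect_vanish => //; first exact: closed_poly.
  - exact: convex_poly.
  - by apply: invariant_poly => c /C'f[].
  - by apply: invariant_poly => c /C'f[].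
- by move=> d; rewrite inE => /eqP -> /=; rewrite !mxE.
- by move=> d; rewrite inE => /eqP -> /=; rewrite !mxE.
Qed.

Definition cube_constraints (N : R) : seq ('cV[R]_n * R) :=
  [seq (evec k, - N) | k : 'I_n] ++ [seq (- evec k, - N) | k : 'I_n].

Lemma poly_cube_constraints N x : poly (cube_constraints N) x <-> forall k, `|x k 0| <= N.
Proof.
split=> [h k|h c].
  have h1 : aff (evec k, - N) x <= 0 by apply: h; rewrite mem_cat; apply/orP; left; apply/mapP; exists k; rewrite ?mem_enum.
  have h2 : aff (- evec k, - N) x <= 0.
    by apply: h; rewrite mem_cat; apply/orP; right; apply/mapP; exists k; rewrite ?mem_enum.
  move: h1 h2; rewrite /aff /= dotvNl !dotv_evecl ler_norml => h1 h2.
  by apply/andP; split; lra.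
rewrite mem_cat => /orP[] /mapP[k _ ->]; rewrite /aff /= ?dotvNl dotv_evecl;
  by have := h k; rewrite ler_norml => /andP[]; lra.
Qed.

(** Elimination of the first coordinate; its hypothesis on cylinders is the
    result of eliminating the second one. *)
Lemma poly_vanish i j C p N : i != j ->
  vanish z (restr (poly C `&` cube N) (fun x => (aff p x)%:E)).
Proof.
move=> ij; have ji : j != i by rewrite eq_sym.
have -> : poly C `&` cube N =
    region i (band j N) [::] [:: (0, - N)] [:: (0, N)] `&` poly (C ++ cube_constraints N).
  rewrite region_band; apply/seteqP; split=> x.
    move=> [Cx xN]; have xk k : `|x k 0| <= N := le_trans (coord_le_norm x k) xN.
    split; first by rewrite /band /=; split; rewrite -ler_norml.
    by move=> c; rewrite mem_cat => /orP[/Cx//|]; exact: (poly_cube_constraints N x).2.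
  move=> [[jx ix] h]; split=> [c cC|].
    by apply: h; rewrite mem_cat cC.
  apply: norm_le_coord => [|k].
    by move: jx; rewrite /band /= -ler_norml; exact: le_trans (normr_ge0 _).
  apply: (poly_cube_constraints N x).1 => c cN.
  by apply: h; rewrite mem_cat cN orbT.
apply: (@elimination i (band j N) (fun=> True)) => //.
- exact: closed_band.
- exact: convex_band.
- exact: invariant_band.
- by move=> C' h p' C'f h0; apply: slab_band_vanish => // c /C'f[].
- by move=> d; rewrite inE => /eqP -> /=; rewrite !mxE.
- by move=> d; rewrite inE => /eqP -> /=; rewrite !mxE.
Qed.

(** Where [b <= a] the function [b] may be dropped from the maximum, and where
    [a <= b] the function [a] may be. *)
Lemma maxaff_vanish i j C a s N : i != j ->
  vanish z (restr (poly C `&` cube N) (fun x => (maxaff a s x)%:E)).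
Proof.
move=> ij; elim: s a C => [|b s IH] a C; first exact: poly_vanish ij.
apply: (cut_vanish zP (g := b - a)); rewrite restr_restr setIA -poly_cons.
  rewrite (@eq_restr _ _ _ _ (fun x => (maxaff a s x)%:E)); first exact: IH.
  move=> x [/(_ _ (mem_head _ _)) + _]; rewrite affB subr_le0 => ba; congr EFin => /=.
  by rewrite max_r // (le_trans ba) // maxaff_ge // mem_head.
rewrite opprB (@eq_restr _ _ _ _ (fun x => (maxaff b s x)%:E)); first exact: IH.
move=> x [/(_ _ (mem_head _ _)) + _]; rewrite affB subr_le0 => ab; congr EFin => /=.
apply/eqP; rewrite eq_le ge_max maxaff_ge ?mem_head //= !maxaff_le /=.
apply/andP; split.
  rewrite (le_trans ab) ?maxaff_ge ?mem_head //=; apply/allP => c cs.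
  by rewrite maxaff_ge // inE cs orbT.
rewrite le_max lexx; apply/allP => c cs.
by rewrite le_max maxaff_ge ?orbT // inE cs orbT.
Qed.

Theorem null_functional_eq0 u : (2 <= n)%N -> Conv_sc u -> z u = 0.
Proof.
move=> n2 cu; pose i := Ordinal (ltnW n2); pose j := Ordinal n2.
have ij : i != j by [].
have [us [cus usE ep]] := maxaff_dense cu.
apply: (vanish_limit zP (us := us)) => // m.
have [a [s [N ->]]] := usE m.
by have := @maxaff_vanish i j [::] a s N ij; rewrite poly_nil setTI.
Qed.

End Polyhedra.
(** * The polar function *)

Section Polar.
Context {R : realType} {n : nat}.
Implicit Types (x y : 'cV[R]_n) (u v w : 'cV[R]_n -> \bar R) (f g : 'cV[R]_n -> R).

Lemma exp_negK u : (forall x, u x != -oo%E) -> neg_log (exp_neg u) = u.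
Proof.
move=> uNy; apply/funext => x; rewrite /neg_log /exp_neg fineK; last first.
  by have := uNy x; case: (u x).
by rewrite expeRK oppeK.
Qed.

Lemma exp_neg_LC u : Conv_sc u -> LC_sc (exp_neg u).
Proof. by move=> cu; exists u. Qed.

Lemma LC_scE f : LC_sc f -> Conv_sc (neg_log f) /\ exp_neg (neg_log f) = f.
Proof. by move=> [u cu ->]; have [uNy _ _ _ _] := cu; rewrite exp_negK. Qed.

Lemma exp_neg_fin u x (r : R) : u x = r%:E -> exp_neg u x = expR (- r).
Proof. by move=> ur; rewrite /exp_neg ur. Qed.

Lemma exp_neg_pinfty u x : u x = +oo%E -> exp_neg u x = 0.
Proof. by move=> ur; rewrite /exp_neg ur. Qed.

Lemma exp_neg_tilt u y : (forall x, u x != -oo%E) ->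
  exp_linear y \* exp_neg u = exp_neg (fun x => u x + (aff (y, 0) x)%:E)%E.
Proof.
move=> uNy; apply/funext => x; rewrite /= /exp_linear.
have := uNy x; case E: (u x) => [r| |] // _.
  rewrite (exp_neg_fin E) (@exp_neg_fin _ x (r + aff (y, 0) x)) ?E //.
  by rewrite -expRD /aff /= dotvC addr0 opprD addrC.
by rewrite !exp_neg_pinfty ?E // mulr0.
Qed.

Lemma exp_neg_le u v x : u x != -oo%E -> (u x <= v x)%E -> exp_neg v x <= exp_neg u x.
Proof.
case E : (u x) => [r| |] // _; last first.
  by rewrite leye_eq => /eqP vx; rewrite !exp_neg_pinfty.
rewrite (exp_neg_fin E); case F : (v x) => [s| |] //.
  by rewrite (exp_neg_fin F) lee_fin ler_expR lerN2.
by rewrite exp_neg_pinfty // expR_ge0.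
Qed.

Lemma exp_neg_min u v : (forall x, u x != -oo%E) -> (forall x, v x != -oo%E) ->
  exp_neg u \max exp_neg v = exp_neg (fun x => mine (u x) (v x)).
Proof.
move=> uNy vNy; apply/funext => x /=; have [uv|vu] := leP (u x) (v x).
  rewrite max_l ?exp_neg_le //.
  by rewrite /exp_neg min_l.
by rewrite max_r ?exp_neg_le ?ltW // /exp_neg min_r // ltW.
Qed.

Lemma exp_neg_max u v : (forall x, u x != -oo%E) -> (forall x, v x != -oo%E) ->
  exp_neg u \min exp_neg v = exp_neg (fun x => maxe (u x) (v x)).
Proof.
move=> uNy vNy; apply/funext => x /=; have [uv|vu] := leP (u x) (v x).
  rewrite min_r ?exp_neg_le //.
  by rewrite /exp_neg max_r.
by rewrite min_l ?exp_neg_le ?ltW // /exp_neg max_l // ltW.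
Qed.

(** The epigraph has a supporting hyperplane of slope [x] with intercept [m];
    equivalently, [- m] is the value at [x] of the Legendre transform. *)
Definition touches u x (m : R) :=
  (forall y, ((aff (x, m) y)%:E <= u y)%E) /\ exists y, u y = (aff (x, m) y)%:E.

Lemma touches_ex u x : Conv_sc u -> exists m, touches u x m.
Proof. by move=> cu; have [m Hm] := best_affine_minorant x cu; exists m. Qed.

Lemma legendre_touches u x m : touches u x m -> legendre u x = (- m)%:E.
Proof.
move=> [um [y uy]]; apply/eqP; rewrite eq_le; apply/andP; split.
  apply: ge_ereal_sup => _ [z _ <-]; have := um z; case: (u z) => [r| |] //.
    by rewrite -EFinB !lee_fin /aff /=; lra.
  by rewrite addeNy leNye.
apply: ereal_sup_ubound; exists y => //; rewrite uy /aff /= -EFinB; congr EFin; ring.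
Qed.

Lemma polar_touches u x m : (forall x, u x != -oo%E) -> touches u x m ->
  polar (exp_neg u) x = expR m.
Proof.
move=> uNy um; rewrite /polar exp_negK //.
by rewrite (@exp_neg_fin _ x (- m)) ?opprK //; exact: legendre_touches.
Qed.

Lemma touches_shift u x y m : touches u x m ->
  touches (fun z => u (z - y)) x (m - dotv x y).
Proof.
move=> [um [a ua]]; split=> [z|].
  apply: le_trans (um (z - y)); rewrite lee_fin /aff /= dotvBr; lra.
by exists (a + y); rewrite addrK ua /aff /= dotvDr; congr EFin; ring.
Qed.

Lemma touches_tilt u x y m : touches u (x - y) m ->
  touches (fun z => u z + (aff (y, 0) z)%:E)%E x m.
Proof.
have e z : aff (x, m) z = aff (x - y, m) z + aff (y, 0) z.
  by rewrite /aff /= dotvBl; ring.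
move=> [um [a ua]]; split=> [z|].
  by rewrite e EFinD; apply: leeD.
by exists a; rewrite ua e EFinD.
Qed.

Lemma touches_mulmx u x (A : 'M[R]_n) m : A \in unitmx -> touches u ((invmx A)^T *m x) m ->
  touches (fun z => u (A *m z)) x m.
Proof.
move=> uA; have e z : aff ((invmx A)^T *m x, m) (A *m z) = aff (x, m) z.
  by rewrite /aff /= -dotv_mulmxr mulKmx.
move=> [um [a ua]]; split=> [z|]; first by rewrite -e.
by exists (invmx A *m a); rewrite mulKVmx // ua -{1}[a](mulKVmx uA) e.
Qed.

(** The two closed sublevel sets cover the segment from [a] to [b], which is
    connected. *)
Lemma common_sublevel_point w1 w2 a b : lower_semicontinuous w1 ->
  lower_semicontinuous w2 -> econvex (fun y => mine (w1 y) (w2 y)) ->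
  (w1 a <= 0)%E -> (w2 b <= 0)%E -> exists y, (w1 y <= 0)%E /\ (w2 y <= 0)%E.
Proof.
move=> l1 l2 cm w1a w2b; pose p (t : R) := t *: b + (1 - t) *: a.
have p0 : p 0 = a by rewrite /p scale0r add0r subr0 scale1r.
have p1 : p 1 = b by rewrite /p scale1r subrr scale0r addr0.
have cover t : 0 <= t <= 1 -> (w1 (p t) <= 0)%E \/ (w2 (p t) <= 0)%E.
  move=> t01; have := econvex_le cm t01 (_ : (mine (w1 b) (w2 b) <= 0%:E)%E)
    (_ : (mine (w1 a) (w2 a) <= 0%:E)%E).
  rewrite !ge_min w1a w2b orbT !mulr0 addr0 => /(_ isT isT).
  by move=> /orP.
have away w t : lower_semicontinuous w -> ~ (w (p t) <= 0)%E ->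
    exists2 d : R, 0 < d & forall t', `|t - t'| < d -> ~ (w (p t') <= 0)%E.
  move=> lw /negP; rewrite -ltNge => /(lscP lw)/nbhs_ballP[e e0 He].
  have k0 : 0 < `|b - a| + 1 by rewrite ltr_wpDl.
  exists (e / (`|b - a| + 1)); first exact: divr_gt0.
  move=> t' tt; apply/negP; rewrite -ltNge; apply: He.
  rewrite -ball_normE /=.
  have -> : p t - p t' = (t - t') *: (b - a).
    by apply/matrixP => i j; rewrite !mxE; ring.
  rewrite normrZ; move: tt; rewrite ltr_pdivlMr //; apply: le_lt_trans.
  by rewrite ler_wpM2l // lerDl.
(* The last parameter at which the first sublevel set is met belongs to both. *)
pose S := [set t : R | 0 <= t <= 1 /\ (w1 (p t) <= 0)%E].
have S0 : S 0 by split; rewrite ?lexx ?ler01 ?p0.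
have supS : has_sup S by split; [exists 0 | exists 1 => t [/andP[]]].
pose s := sup S.
have s01 : 0 <= s <= 1.
  apply/andP; split; first by apply: sup_upper_bound.
  by apply: ge_sup; [exists 0 | move=> t [/andP[]]].
exists (p s); split; apply: contrapT => /away[] // d d0 Hd.
  have [t [t01 wt] st] := sup_adherent d0 supS.
  have ts : t <= s by apply: sup_upper_bound.
  by apply: (Hd t) => //; rewrite ger0_norm ?subr_ge0 //; move: st; rewrite -/s; lra.
have s1 : s < 1.
  rewrite lt_neqAle (andP s01).2 andbT; apply/eqP => s1.
  by apply: (Hd s); [rewrite subrr normr0 | rewrite s1 p1].
pose t := Num.min 1 (s + d / 2).
have st : s < t by rewrite lt_min s1 ltrDl divr_gt0.
have td : t <= s + d / 2 by rewrite ge_min lexx orbT.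
have t01 : 0 <= t <= 1.
  by rewrite ge_min lexx andbT (le_trans (andP s01).1) // ltW.
have [w1t|] := cover t t01.
  have : t <= s by apply: sup_upper_bound => //; split.
  by rewrite leNgt st.
by apply: Hd; rewrite distrC ger0_norm ?subr_ge0 ?ltW //; lra.
Qed.

Lemma touches_min u v x m1 m2 : touches u x m1 -> touches v x m2 ->
  touches (fun y => mine (u y) (v y)) x (Num.min m1 m2).
Proof.
move=> [um [a ua]] [vm [b vb]]; split=> [y|].
  rewrite le_min; apply/andP; split.
    by apply: le_trans (um y); rewrite lee_fin lerD2l ge_min lexx.
  by apply: le_trans (vm y); rewrite lee_fin lerD2l ge_min lexx orbT.
have [m12|m21] := leP m1 m2.
  exists a; rewrite ua min_l //; apply: le_trans (vm a).
  by rewrite lee_fin lerD2l.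
exists b; rewrite vb min_r //; apply: le_trans (um b).
by rewrite lee_fin lerD2l ltW.
Qed.

(** After subtraction of the affine function with the larger intercept both
    functions have a nonpositive value, and a common sublevel point is a
    contact point of the maximum. *)
Lemma touches_max u v x m1 m2 : Conv_sc u -> Conv_sc v ->
  Conv_sc (fun y => mine (u y) (v y)) -> touches u x m1 -> touches v x m2 ->
  touches (fun y => maxe (u y) (v y)) x (Num.max m1 m2).
Proof.
move=> cu cv cm [um [a ua]] [vm [b vb]]; set m := Num.max m1 m2.
have lower y : ((aff (x, m) y)%:E <= maxe (u y) (v y))%E.
  rewrite le_max /m; have [m12|m21] := leP m1 m2; first by rewrite vm orbT.
  by rewrite um.
split=> //.
pose q : 'cV[R]_n * R := (- x, - m).
have qE y : aff q y = - aff (x, m) y by rewrite /aff /= dotvNl; ring.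
have [_ _ _ l1 _] := Conv_sc_add_aff q cu; have [_ _ _ l2 _] := Conv_sc_add_aff q cv.
have cq : econvex (fun y => mine (u y + (aff q y)%:E)%E (v y + (aff q y)%:E)%E).
  have [_ _ cq _ _] := Conv_sc_add_aff q cm.
  have -> : (fun y => mine (u y + (aff q y)%:E)%E (v y + (aff q y)%:E)%E) =
    (fun y => mine (u y) (v y) + (aff q y)%:E)%E.
    apply/funext => y; have [uv|vu] := leP (u y) (v y).
      by rewrite min_l // leeD2r.
    by rewrite min_r // leeD2r // ltW.
  exact: cq.
have [||y []] := common_sublevel_point l1 l2 cq (a := a) (b := b).
- by rewrite ua qE -EFinB lee_fin subr_le0 lerD2l le_max lexx.
- by rewrite vb qE -EFinB lee_fin subr_le0 lerD2l le_max lexx orbT.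
rewrite qE EFinN !sube_le0 => uy vy; exists y.
by apply/eqP; rewrite eq_le lower andbT ge_max uy vy.
Qed.

(** Coercivity of the limit traps the minimizers: on a large sphere the
    approximating functions eventually exceed their values at a recovery
    sequence, and convexity propagates this to the exterior. *)
Lemma epi_lower_bound (vs : nat -> 'cV[R]_n -> \bar R) v (ws : nat -> 'cV[R]_n)
    (w : 'cV[R]_n) (m : R) :
  (forall i, econvex (vs i)) -> coercive setT v -> epi_liminf vs v ->
  (forall y, (m%:E <= v y)%E) -> ws @ \oo --> w ->
  (\forall i \near \oo, (vs i (ws i) <= (m + 1)%:E)%E) ->
  forall e : R, 0 < e -> \forall i \near \oo, forall y, ((m - e)%:E < vs i y)%E.
Proof.
move=> cvs sv ep vm wsw wm e e0.
(* Every point of norm at least [r] has value more than [m + 1] under [v]. *)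
have [B HB] := sv 1; pose r := `|w| + `|m + 1 + B| + 1.
have far y : r <= `|y| -> ((m + 1)%:E < v y)%E.
  move=> ry; apply: lt_le_trans (HB y I); rewrite lte_fin mul1r.
  by have := ler_norm (m + 1 + B); have := normr_ge0 w; move: ry; rewrite /r; lra.
have cK : compact [set y : 'cV[R]_n | `|y| <= r].
  have := @closed_ball_compact R n 0 r.
  by congr compact; apply/seteqP; split=> y /=; rewrite subr0.
move/compact_near_coveringP in cK.
have near_K : \forall i \near \oo, [set y : 'cV[R]_n | `|y| <= r] `<=`
    [set y | ((m - e)%:E < vs i y)%E /\ (r <= `|y| -> ((m + 1)%:E < vs i y)%E)].
  apply: cK => y /= yr; have FF := nbhs_filter y.
  have [[A1 A2] /= [A1y A2n] A] : \forall y' \near y & i \near \oo, ((m - e)%:E < vs i y')%E.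
    by apply: ep; apply: lt_le_trans (vm y); rewrite lte_fin ltrBlDr ltrDl.
  have [yr1|yr1] := ltP `|y| r.
    exists (A1 `&` [set y' | `|y - y'| <= (r - `|y|) / 2], A2) => /=.
      by split=> //; apply: filterI => //; apply: near_dist_le; lra.
    move=> [y' i] /= [[A1y' yy] A2i]; split; first exact: (A (y', i)).
    move=> ry'; exfalso.
    by have := lerB_normD y' (- y); rewrite normrN distrC; lra.
  have [[C1 C2] /= [C1y C2n] C] := ep y (m + 1) (far y yr1).
  exists (A1 `&` C1, A2 `&` C2) => /=; first by split; exact: filterI.
  move=> [y' i] /= [[A1y' C1y'] [A2i C2i]].
  by split; [exact: (A (y', i)) | move=> _; exact: (C (y', i))].
have wr : \forall i \near \oo, `|ws i| < r.
  have : `|ws i| @[i --> \oo] --> `|w| by exact: cvg_norm.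
  move=> /cvgr_lt; apply; rewrite /r.
  by have := normr_ge0 (m + 1 + B); lra.
near=> i.
have Ki : [set y : 'cV[R]_n | `|y| <= r] `<=`
    [set y | ((m - e)%:E < vs i y)%E /\ (r <= `|y| -> ((m + 1)%:E < vs i y)%E)] by near: i.
have wri : `|ws i| < r by near: i.
have wmi : (vs i (ws i) <= (m + 1)%:E)%E by near: i.
move=> y; have [yr|ry] := leP `|y| r; first by have [] := Ki y yr.
apply: (@lt_trans _ _ (m + 1)%:E); first by rewrite lte_fin; lra.
rewrite ltNge; apply/negP => ym.
pose p (t : R) := t *: y + (1 - t) *: ws i.
have cp : {within `[0, 1], continuous (fun t => `|p t|)}.
  apply: continuous_subspaceT => t; apply: cvg_norm; rewrite /p.
  apply: cvgD; first by apply: cvgZl; exact: cvg_id.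
  by apply: cvgZl; apply: cvgB; [exact: cvg_cst | exact: cvg_id].
have [|t] := IVT (@ler01 R) cp (v := r); rewrite /p.
  rewrite !(scale0r, scale1r, subr0, subrr, add0r, addr0) ge_min le_max.
  by rewrite !(ltW wri) (ltW ry) orbT.
rewrite in_itv /= => t01; rewrite -/(p t).
move=> tr; have ptr : `|p t| <= r by rewrite tr.
have [_] := Ki (p t) ptr; rewrite tr lexx => /(_ isT).
have := econvex_le (cvs i) t01 ym wmi; rewrite -mulrDl subrKC mul1r => h1.
by rewrite ltNge h1.
Unshelve. all: by end_near. Qed.

Lemma epi_liminf_add_aff (us : nat -> 'cV[R]_n -> \bar R) u p :
  (forall i x, us i x != -oo%E) -> epi_liminf us u ->
  epi_liminf (fun i x => us i x + (aff p x)%:E)%E (fun x => u x + (aff p x)%:E)%E.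
Proof.
move=> usNy lo x M; rewrite -lteBlDr // -EFinB => Mu.
have [b bu Mb] : exists2 b : R, (b%:E < u x)%E & M - aff p x < b.
  move: Mu; case: (u x) => [c| |] //.
    rewrite lte_fin => Mc; exists (c - (c - (M - aff p x)) / 2); last by lra.
    by rewrite lte_fin; lra.
  by exists (M - aff p x + 1); [rewrite ltry | lra].
have [[A1 A2] /= [A1x A2n] A] := lo x b bu; have FF := nbhs_filter x.
exists (A1 `&` [set y | M - b < aff p y], A2) => /=.
  by split=> //; apply: filterI => //; apply: near_aff_gt; lra.
move=> [y i] /= [[A1y py] A2i]; rewrite -lteBlDr // -EFinB.
apply: lt_trans (A (y, i) (conj A1y A2i)); rewrite lte_fin; lra.
Qed.

(** The intercepts are the minima of the functions minus a linear one: a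
    recovery sequence bounds them from above. *)
Lemma touches_cvg (us : nat -> 'cV[R]_n -> \bar R) u x (ms : nat -> R) m :
  (forall i, Conv_sc (us i)) -> Conv_sc u -> epi_converges us u ->
  (forall i, touches (us i) x (ms i)) -> touches u x m -> ms @ \oo --> m.
Proof.
move=> cus cu ep tus [um [w uw]].
have cq := Conv_sc_add_aff (- x, 0) cu.
have qE y : aff (- x, 0) y = - dotv x y by rewrite /aff /= dotvNl addr0.
have [_ [ws wsw uws]] := ep w.
have close (d : R) : 0 < d -> \forall i \near \oo,
    (us i (ws i) + (aff (- x, 0) (ws i))%:E <= (m + d)%:E)%E.
  move=> d0; have d2 : 0 < d / 2 by rewrite divr_gt0.
  have h1 : \forall i \near \oo, (us i (ws i) < (aff (x, m) w + d / 2)%:E)%E.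
    rewrite uw in uws; move/fine_cvgP: uws => [fin /cvgrPdist_lt /(_ _ d2) cv].
    apply: filterS2 fin cv => i /=; case: (us i (ws i)) => [r| |] // _ /=.
    by rewrite ltr_norml lte_fin /= => /andP[h _]; lra.
  have h2 : \forall i \near \oo, dotv x w - d / 2 < aff (x, 0) (ws i).
    apply: (wsw [set y | dotv x w - d / 2 < aff (x, 0) y]).
    by apply: near_aff_gt; rewrite /aff /= addr0; lra.
  apply: filterS2 h1 h2 => i; case: (us i (ws i)) => [r| |] // h1 h2; last by rewrite addNye leNye.
  by move: h1 h2; rewrite qE -EFinD lte_fin lee_fin /aff /= => h1 h2; lra.
have lower : forall e : R, 0 < e -> \forall i \near \oo, forall y,
    ((m - e)%:E < us i y + (aff (- x, 0) y)%:E)%E.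
  apply: (@epi_lower_bound _ (fun y => u y + (aff (- x, 0) y)%:E)%E ws w).
  - by move=> i; have [_ _ ? _ _] := Conv_sc_add_aff (- x, 0) (cus i).
  - exact: Conv_sc_coercive.
  - apply: epi_liminf_add_aff; last exact: epi_converges_liminf.
    by move=> i y; have [uNy _ _ _ _] := cus i.
  - move=> y; have := um y; case: (u y) => [r| |] //; rewrite ?leey //.
    by rewrite qE -EFinD !lee_fin /aff /=; lra.
  - exact: wsw.
  - exact: close.
apply/cvgrPdist_le => e e0.
apply: filterS2 (close e e0) (lower e e0) => i up lo.
have [umi [y uy]] := tus i.
have lo' : m - e < ms i.
  have := lo y; rewrite uy qE -EFinD lte_fin /aff /=; lra.
have up' : ms i <= m + e.
  move: up; have := umi (ws i); case: (us i (ws i)) => [r| |] //.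
  by rewrite qE -EFinD !lee_fin /aff /=; lra.
by rewrite ler_norml; apply/andP; split; lra.
Qed.

End Polar.

(** * The theorem *)

Section Characterization.
Context {R : realType} {n : nat}.
Implicit Types (x y : 'cV[R]_n) (u v : 'cV[R]_n -> \bar R) (f g : 'cV[R]_n -> R)
  (Z : ('cV[R]_n -> R) -> ('cV[R]_n -> R)).

Lemma LC_translate f y : LC_sc f -> LC_sc (translate y f).
Proof. by move=> [u cu ->]; exact: exp_neg_LC (Conv_sc_shift (- y) cu). Qed.

Lemma LC_tilt f y : LC_sc f -> LC_sc (exp_linear y \* f).
Proof.
move=> [u cu ->]; have [uNy _ _ _ _] := cu; rewrite exp_neg_tilt //.
exact: exp_neg_LC (Conv_sc_add_aff _ cu).
Qed.

Lemma LC_mulmx f (A : 'M[R]_n) : A \in unitmx -> LC_sc f -> LC_sc (fun x => f (A *m x)).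
Proof. by move=> uA [u cu ->]; exact: exp_neg_LC (Conv_sc_mulmx uA cu). Qed.

Lemma LC_touches f x : LC_sc f -> exists u m,
  [/\ Conv_sc u, f = exp_neg u, touches u x m & polar f x = expR m].
Proof.
move=> [u cu ->]; have [m um] := touches_ex x cu; exists u, m; split=> //.
by apply: polar_touches um; have [] := cu.
Qed.

Definition admissible Z : Prop :=
  [/\ hypo_continuous Z, SL_contravariant Z, is_valuation Z &
      translation_conjugation Z].

Lemma polar_admissible (c : R) Z :
  (forall f, LC_sc f -> Z f = (fun x => c * polar f x)) -> admissible Z.
Proof.
move=> Zc; split.
- move=> fs f cfs cf ep x.
  rewrite Zc //; under eq_fun do rewrite Zc //.
  apply: cvgM; first exact: cvg_cst.
  have [cu <-] := LC_scE cf.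
  have [m um] := touches_ex x cu.
  have cus i := (LC_scE (cfs i)).1.
  have [ms ums] := choice (fun i => touches_ex x (cus i)).
  rewrite (polar_touches _ um); last by have [] := cu.
  have -> : (fun i => polar (fs i) x) = (fun i => expR (ms i)).
    apply/funext => i; rewrite -(LC_scE (cfs i)).2 (polar_touches _ (ums i)) //.
    by have [] := cus i.
  apply: continuous_cvg; first exact: continuous_expR.
  exact: (touches_cvg cus cu ep ums um).
- move=> f A cf dA; have uA : invmx A \in unitmx by rewrite unitmx_inv unitmx_det1.
  rewrite !Zc //; last exact: LC_mulmx.
  apply/funext => x; congr (_ * _).
  have [u [m [cu -> um ->]]] := LC_touches (A^T *m x) cf.
  apply: (@polar_touches _ _ (fun x => u (invmx A *m x))); first by have [] := cu.
  by apply: touches_mulmx; rewrite ?invmxK.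
- move=> f g cf cg cfg1 cfg2.
  rewrite !Zc //; apply/funext => x /=; rewrite -!mulrDr; congr (_ * _).
  have [u [m1 [cu fu um ->]]] := LC_touches x cf.
  have [v [m2 [cv gv vm ->]]] := LC_touches x cg.
  have [uNy _ _ _ _] := cu; have [vNy _ _ _ _] := cv.
  have minNy y : mine (u y) (v y) != -oo%E by case: leP.
  have maxNy y : maxe (u y) (v y) != -oo%E by case: leP.
  rewrite fu gv exp_neg_min // in cfg1 *; rewrite exp_neg_max //.
  have cm : Conv_sc (fun y => mine (u y) (v y)).
    by rewrite -[X in Conv_sc X]exp_negK //; exact: (LC_scE cfg1).1.
  rewrite (polar_touches minNy (touches_min um vm)).
  rewrite (polar_touches maxNy (touches_max cu cv cm um vm)).
  by case: leP => _ //; rewrite addrC.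
- move=> f y cf; rewrite !Zc //; [|exact: LC_tilt|exact: LC_translate].
  split; apply/funext => x /=.
    have [u [m [cu -> um ->]]] := LC_touches x cf.
    rewrite (@polar_touches _ _ (fun z => u (z - y)) _ _ _ (touches_shift y um)).
      by rewrite expRD /exp_linear; ring.
    by have [] := cu.
  rewrite /translate; congr (_ * _).
  have [u [m [cu -> um ->]]] := LC_touches (x - y) cf.
  have [uNy _ _ _ _] := cu; rewrite exp_neg_tilt //.
  by apply: polar_touches (touches_tilt um) => z; have := uNy z; case: (u z).
Qed.

Lemma admissibleB Z1 Z2 : admissible Z1 -> admissible Z2 ->
  admissible (fun f x => Z1 f x - Z2 f x).
Proof.
move=> [c1 s1 v1 t1] [c2 s2 v2 t2]; split.
- by move=> fs f cfs cf ep x; apply: cvgB; [exact: c1 | exact: c2].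
- by move=> f A cf dA; rewrite s1 ?s2.
- move=> f g cf cg h1 h2; apply/funext => x /=.
  have := congr1 (@^~ x) (v1 f g cf cg h1 h2); have := congr1 (@^~ x) (v2 f g cf cg h1 h2).
  by rewrite /=; lra.
- move=> f y cf; have [e1 e2] := t1 f y cf; have [e3 e4] := t2 f y cf.
  by rewrite e1 e2 e3 e4; split=> //; apply/funext => x /=; ring.
Qed.

(** The translation by [r a] and its inverse, separated by a tilt with slope
    [a], produce the scalar factor [expR r] since [a] is a unit vector: both
    conjugation rules together make the value at the origin homogeneous. *)
Lemma admissible_scale Z f (r : R) : (0 < n)%N -> translation_conjugation Z -> LC_sc f ->
  Z (fun x => expR (- r) * f x) 0 = expR r * Z f 0.
Proof.
move=> n0 tZ cf; pose a : 'cV[R]_n := evec (Ordinal n0).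
have aa : dotv a a = 1 by rewrite dotv_evec evecE eqxx.
pose f1 := translate (r *: a) f; have c1 : LC_sc f1 by exact: LC_translate.
pose f2 := exp_linear a \* f1; have c2 : LC_sc f2 by exact: LC_tilt.
pose f3 := translate (- (r *: a)) f2; have c3 : LC_sc f3 by exact: LC_translate.
have -> : (fun x => expR (- r) * f x) = exp_linear (- a) \* f3.
  apply/funext => x; rewrite /f3 /f2 /f1 /translate /exp_linear /= opprK addrK.
  rewrite mulrA -expRD; congr (expR _ * _).
  by rewrite dotvNr dotvDl dotvZl aa; ring.
rewrite (tZ f3 (- a) c3).2 /translate opprK add0r.
rewrite (tZ f2 (- (r *: a)) c2).1 /= (tZ f1 a c1).2 /translate subrr.
rewrite (tZ f (r *: a) cf).1 /= /exp_linear dotv0l oppr0 expR0 mul1r.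
by rewrite dotvNr dotvZr aa mulr1 opprK.
Qed.

Lemma admissible_null Z : (0 < n)%N -> admissible Z ->
  Z (exp_neg (restr [set 0] (fun=> 0%E))) 0 = 0 ->
  null_functional (fun u => Z (exp_neg u) 0).
Proof.
move=> n0 [cZ sZ vZ tZ] Z0; split=> //.
- move=> us u cus cu ep; apply: cZ => //; try exact: exp_neg_LC.
    by move=> i; exact: exp_neg_LC.
  rewrite /hypo_converges exp_negK; last by have [] := cu.
  have -> : (fun i => neg_log (exp_neg (us i))) = us; last exact: ep.
  by apply/funext => i; rewrite exp_negK //; have [] := cus i.
- move=> u A cu dA; have uA := unitmx_det1 dA.
  have := congr1 (@^~ 0) (sZ (exp_neg u) (invmx A) (exp_neg_LC cu) _).
  by rewrite det_inv dA invr1 => /(_ erefl); rewrite mulmx0 invmxK.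
- move=> u v cu cv cmax cmin.
  have [uNy _ _ _ _] := cu; have [vNy _ _ _ _] := cv.
  have := congr1 (@^~ 0) (vZ _ _ (exp_neg_LC cu) (exp_neg_LC cv) _ _).
  rewrite exp_neg_min // exp_neg_max // => /(_ (exp_neg_LC cmin) (exp_neg_LC cmax)) /= <-.
  exact: addrC.
- move=> u y cu; have := congr1 (@^~ 0) (tZ _ (- y) (exp_neg_LC cu)).1.
  rewrite /= /exp_linear dotv0l oppr0 expR0 mul1r => <-.
  by congr (Z _ 0); apply/funext => x; rewrite /translate opprK.
- move=> u r cu; have [uNy _ _ _ _] := cu.
  rewrite -(admissible_scale r n0 tZ (exp_neg_LC cu)); congr (Z _ 0).
  apply/funext => x; have := uNy x; case E : (u x) => [s| |] // _.
    rewrite (exp_neg_fin E) (@exp_neg_fin _ _ _ x (s + r)) ?E //.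
    by rewrite opprD expRD mulrC.
  by rewrite !exp_neg_pinfty ?E ?mulr0.
Qed.

(** A tilt moves any point to the origin. *)
Lemma admissible_eq0 Z f : (2 <= n)%N -> admissible Z ->
  Z (exp_neg (restr [set 0] (fun=> 0%E))) 0 = 0 -> LC_sc f -> Z f = (fun=> 0).
Proof.
move=> n2 aZ Z0 cf; have nZ := admissible_null (ltnW n2) aZ Z0.
have zero g : LC_sc g -> Z g 0 = 0.
  by move=> [u cu ->]; exact: (null_functional_eq0 nZ n2 cu).
apply/funext => x; have [_ _ _ tZ] := aZ.
have := zero _ (LC_tilt (- x) cf).
by rewrite (tZ f (- x) cf).2 /translate opprK add0r.
Qed.

End Characterization.

Theorem theorem1p2 (R : realType) (n : nat) (hn : (3 <= n)%N)
    (Z : ('cV[R]_n -> R) -> ('cV[R]_n -> R)) :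
  [/\ hypo_continuous Z, SL_contravariant Z, is_valuation Z &
      translation_conjugation Z] <->
  exists c : R, forall f : 'cV[R]_n -> R, LC_sc f -> Z f = (fun x => c * polar f x).
Proof.
split=> [aZ|[c Zc]]; last exact: (polar_admissible Zc).
pose o : 'cV[R]_n -> \bar R := restr [set 0] (fun=> 0%E).
have co : Conv_sc o := Conv_sc_point.
have o1 : polar (exp_neg o) 0 = 1.
  rewrite (@polar_touches _ _ o 0 0) ?expR0 //; first by have [] := co.
  split=> [y|]; last by exists 0; rewrite /o restr_in // /aff /= dotv0l addr0.
  by apply: le_trans (le_restr _ _ _); rewrite /aff /= dotv0l addr0.
(* The polar function of the indicator function of the origin has value one. *)
exists (Z (exp_neg o) 0) => f cf.
have aP := @polar_admissible R n (Z (exp_neg o) 0) (fun f x => Z (exp_neg o) 0 * polar f x)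
  (fun _ _ => erefl).
have := admissible_eq0 (ltnW hn) (admissibleB aZ aP) _ cf.
rewrite o1 mulr1 subrr => /(_ erefl) h; apply/funext => x.
by apply/eqP; rewrite -subr_eq0; have := congr1 (@^~ x) h => /= ->.
Qed.
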